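(* There exists a separable surface carrying a foliation (of dimension $1$) in which all leaves except one are real lines (homeomorphic to $\mathbb R$), the exceptional leaf being a long ray (homeomorphic to $\mathbb L_+$). Thus leaves neighbouring a long leaf need not be long: every neighbourhood of the exceptional long leaf meets leaves that are not long.
   Context: Manifolds are connected Hausdorff, locally Euclidean spaces (not assumed metrisable or second countable), without boundary. A surface is a $2$-dimensional manifold. A foliation (always of dimension $1$, topological) on an $n$-manifold $M$ is given by a maximal atlas of foliated charts $\varphi:U\to\mathbb R\times\mathbb R^{n-1}$ (homeomorphisms from open sets $U$ covering $M$ onto open boxes) whose coordinate changes are locally of the form $(x,y)\mapsto(f(x,y),g(y))$ with $y\in\mathbb R^{n-1}$. Plaques are the sets $\varphi^{-1}(\mathbb R\times\{y\})$; the leaf topology on $M$ is the topology generated by the open subsets of plaques, and leaves are the connected components of $M$ in the leaf topology, each a connected $1$-manifold. The homeomorphism type of a leaf refers to its leaf topology. The closed long ray $\mathbb L_{\ge0}$ is $\omega_1\times[0,1)$ with the lexicographic order topology; the open long ray (or just long ray) is $\mathbb L_+=\mathbb L_{\ge0}\setminus\{0\}$; the long line $\mathbb L$ is obtained by gluing two copies of $\mathbb L_{\ge 0}$ along their endpoint $0$. Every connected Hausdorff $1$-manifold is homeomorphic to exactly one of $\mathbb S^1,\mathbb R,\mathbb L_+,\mathbb L$; a leaf is short if it is homeomorphic to $\mathbb S^1$ or $\mathbb R$, and long otherwise. *)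

(* Defs.v *)
From HB Require Import structures.
From mathcomp Require Import all_boot all_order all_algebra.
From mathcomp Require Import all_classical wochoice all_reals all_analysis.

Set Implicit Arguments.
Unset Strict Implicit.
Unset Printing Implicit Defensive.

Import Order.TTheory GRing.Theory Num.Theory.
Import numFieldNormedType.Exports.

Local Open Scope classical_set_scope.
Local Open Scope ring_scope.

(* [f] restricts to a homeomorphism from [A] onto [B], both with their subspace
   topologies; the values of [f] outside [A] are irrelevant. *)
Definition homeomorphism_on (X Y : topologicalType) (A : set X) (B : set Y)
    (f : X -> Y) :=
  exists g : Y -> X,
    [/\ set_fun A B f /\ set_fun B A g,
        {in A, cancel f g} /\ {in B, cancel g f},
        {within A, continuous f} & {within B, continuous g}].

Definition homeomorphic (X Y : topologicalType) (A : set X) (B : set Y) :=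
  exists f, homeomorphism_on A B f.

Definition locally_euclidean (R : realType) (n : nat) (M : topologicalType) :=
  forall p : M, exists (U : set M) (V : set 'rV[R]_n),
    [/\ open U, U p, open V & homeomorphic U V].

Definition manifold (R : realType) (n : nat) (M : topologicalType) :=
  [/\ connected [set: M], hausdorff_space M & locally_euclidean R n M].

Definition surface (R : realType) (M : topologicalType) := manifold R 2 M.

Definition separable (M : topologicalType) :=
  exists2 D : set M, countable D & dense D.

Section Foliations.
Context (R : realType) (n : nat) (M : topologicalType).

Definition open_box (B : set (R * 'rV[R]_n.-1)) :=
  exists (I : interval R) (J : 'I_n.-1 -> interval R),
    [/\ itv_open_ends I, forall i, itv_open_ends (J i), B !=set0 &
        B = [set` I] `*` [set y : 'rV[R]_n.-1 | forall i, y 0 i \in J i]].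

(* A chart U -> R x R^(n-1) is a pair (U, phi) with phi totalised
   arbitrarily outside U. *)
Definition chart : Type := set M * (M -> R * 'rV[R]_n.-1).

Definition box_chart (c : chart) :=
  open c.1 /\ exists2 B, open_box B & homeomorphism_on c.1 B c.2.

(* The coordinate change sends [c.2 q] to [c'.2 q]. As [c.2] is a homeomorphism
   onto its image, "near [c.2 p]" is the same as "[q] near [p]". *)
Definition foliated_change (c c' : chart) :=
  forall p, (c.1 `&` c'.1) p ->
    exists (f : R * 'rV[R]_n.-1 -> R) (g : 'rV[R]_n.-1 -> 'rV[R]_n.-1),
      \forall q \near p, c'.2 q = (f (c.2 q), g (c.2 q).2).

Record foliation := Foliation {
  atlas : set chart;
  atlas_box_chart : forall c, atlas c -> box_chart c;
  atlas_cover : forall p, exists2 c, atlas c & c.1 p;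
  atlas_change : forall c c', atlas c -> atlas c' -> foliated_change c c';
  atlas_maximal : forall c, box_chart c ->
    (forall c', atlas c' -> foliated_change c c' /\ foliated_change c' c) ->
    atlas c }.

Definition plaque (F : foliation) (P : set M) :=
  exists2 c, atlas F c & exists y, P = c.1 `&` [set p | (c.2 p).2 = y].

Definition open_in_plaque (F : foliation) (A : set M) :=
  exists2 P, plaque F P & exists2 O : set M, open O & A = O `&` P.

Definition leaf_space (F : foliation) : Type := M.

HB.instance Definition _ (F : foliation) := Choice.on (leaf_space F).

HB.instance Definition _ (F : foliation) :=
  @isSubBaseTopological.Build (leaf_space F) (set M) (open_in_plaque F) id.

Definition leaf (F : foliation) (L : set (leaf_space F)) :=
  exists p, L = connected_component setT p.

End Foliations.

(* The order type of the ordinal omega_1: in a well-ordering of the uncountable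
   set of subsets of nat, the elements having only countably many predecessors.
   See [omega1_min], [omega1_countable] and [omega1_uncountable]. *)
Definition wo_sets : Type := set nat.

HB.instance Definition _ := Choice.on wo_sets.

Definition wo_le : rel wo_sets := projT1 (well_ordering_principle wo_sets).

Lemma wo_leP : well_order wo_le.
Proof. exact: projT2 (well_ordering_principle wo_sets). Qed.

Lemma wo_le_chain : wo_chain wo_le predT.
Proof. by move=> A _; exact: wo_leP. Qed.

Lemma wo_le_total : total wo_le.
Proof. by move=> x y; exact: (wo_chainW wo_le_chain). Qed.

Lemma wo_le_anti : antisymmetric wo_le.
Proof. by move=> x y; exact: (wo_chain_antisymmetric wo_le_chain). Qed.

Lemma wo_le_trans : transitive wo_le.
Proof.
move=> y x z xy yz.
have [|m [[mA mle] _]] := @wo_leP (mem [:: x; y; z]).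
  by exists x; rewrite inE eqxx.
have xx t : wo_le t t by have := wo_le_total t t; rewrite orbb.
move: mA; rewrite !inE => /or3P[] /eqP mE; subst m.
- by apply: mle; rewrite !inE eqxx !orbT.
- have yx : wo_le y x by apply: mle; rewrite !inE eqxx.
  by have -> : x = y by apply: wo_le_anti; rewrite xy yx.
- have zy : wo_le z y by apply: mle; rewrite !inE eqxx orbT.
  by have <- : y = z by apply: wo_le_anti; rewrite yz zy.
Qed.

Fact wo_display : Order.disp_t. Proof. exact: Order.Disp tt tt. Qed.

HB.instance Definition _ := @Order.Le_isPOrder.Build wo_display wo_sets wo_le
  (fun x => etrans (esym (orbb _)) (wo_le_total x x)) wo_le_anti wo_le_trans.

HB.instance Definition _ :=
  @Order.POrder_isTotal.Build wo_display wo_sets wo_le_total.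

Definition omega1 : Type :=
  {x : wo_sets | `[< countable [set y : wo_sets | (y < x)%O] >]}.

HB.instance Definition _ := SubChoice.on omega1.

HB.instance Definition _ :=
  [SubChoice_isSubOrder of omega1 by <: with wo_display].

Lemma omega1_min (A : set omega1) : A !=set0 ->
  exists2 m, A m & forall x, A x -> (m <= x)%O.
Proof.
move=> [a Aa]; pose B : {pred wo_sets} := fun s => `[< (val @` A) s >].
have [|m [[mB mle] _]] := @wo_leP B.
  by exists (val a); apply/asboolP; exists a.
move: mB => /asboolP[m' Am' m'E]; exists m' => // x Ax.
rewrite -[(_ <= _)%O]/(wo_le (val m') (val x)) m'E; apply: mle.
by apply/asboolP; exists x.
Qed.

Lemma omega1_countable (x : omega1) : countable [set y : omega1 | (y < x)%O].
Proof.
have /asboolP cx := valP x.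
have : countable (val @` [set y : omega1 | (y < x)%O]).
  by apply: sub_countable cx; apply: subset_card_le => _ [y yx <-].
rewrite (eq_countable (inj_card_eq _))//.
by move=> y z _ _; exact: val_inj.
Qed.

Lemma omega1_uncountable : ~ countable [set: omega1].
Proof.
move=> c1.
pose A := [set x : wo_sets | countable [set y : wo_sets | (y < x)%O]].
have cA : countable A.
  have : countable (val @` [set: omega1]).
    by apply: sub_countable c1; exact: card_image_le.
  apply: sub_countable; apply: subset_card_le => x Ax.
  by exists (exist _ x (asboolT Ax)).
have [AT|nAT] := pselect (forall x, A x).
  have /pcard_injP[f finj] := cA.
  pose D := [set k | exists x : wo_sets, f x = k /\ ~ (x : set nat) k].
  have fi : injective f by move=> x y; apply: finj; rewrite inE; exact: AT.
  have DP : ~ D (f D) -> D (f D) by move=> nD; exists D.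
  have : D (f D) by have [//|/DP] := pselect (D (f D)).
  by move=> /[dup] + [x [/fi ->]].
have [x0 Ax0] : exists x, ~ A x by apply/existsNP.
have [|m [[mB mle] _]] := @wo_leP (fun s => `[< ~ A s >]).
  by exists x0; apply/asboolP.
move: mB => /asboolP; apply; apply: sub_countable cA.
apply: subset_card_le => y /= ym; apply: contrapT => nAy.
have : wo_le m y by apply: mle; apply/asboolP.
by rewrite -[wo_le m y]/(m <= y)%O leNgt ym.
Qed.

Lemma omega1_nonempty : [set: omega1] !=set0.
Proof.
apply/set0P; apply/eqP => E; apply: omega1_uncountable.
by rewrite E; exact: countable0.
Qed.

Definition omega1_0 : omega1 := s2val (cid2 (omega1_min omega1_nonempty)).

Lemma omega1_0_le (x : omega1) : (omega1_0 <= x)%O.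
Proof. exact: (s2valP' (cid2 (omega1_min omega1_nonempty))). Qed.

Section LongRay.
Variable R : realType.

Definition unit_co : Type := {t : R | 0 <= t < 1}.

HB.instance Definition _ := SubChoice.on unit_co.

HB.instance Definition _ :=
  [SubChoice_isSubOrder of unit_co by <: with ring_display].

Definition unit_co_0 : unit_co :=
  exist (fun t : R => 0 <= t < 1) 0 (introT andP (conj (lexx 0) ltr01)).

Definition closed_long_ray : Type := order_topology (omega1 *l unit_co).

HB.instance Definition _ := OrderTopological.on closed_long_ray.

Definition long_ray : set closed_long_ray := ~` [set (omega1_0, unit_co_0)].

Definition circle : set (R * R) := [set z | z.1 ^+ 2 + z.2 ^+ 2 = 1].

End LongRay.

Arguments long_ray R : clear implicits.
Arguments circle R : clear implicits.

Section LeafTypes.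
Context (R : realType) (n : nat) (M : topologicalType) (F : foliation R n M).

Definition short_leaf (L : set (leaf_space F)) :=
  leaf L /\ (homeomorphic L (circle R) \/ homeomorphic L [set: R]).

Definition long_leaf (L : set (leaf_space F)) := leaf L /\ ~ short_leaf L.

End LeafTypes.

(* Main.v *)
Require Import Defs.
From HB Require Import structures.
From mathcomp Require Import all_boot all_order all_algebra finmap.
From mathcomp Require Import all_classical all_reals all_analysis.
From mathcomp Require Import lra.

(** Start from two copies of the plane, each foliated by its vertical lines
    [{x} * R], and let the lines of both copies run, as [x] tends to [+oo],
    to one common new leaf, a long ray.  The point of height [r] in the block
    [a < omega1] of the ray is declared to be the limit of the points
    [(x, f_a x + r)], where the functions [f_a] form an [omega1]-chain for
    eventual domination: [f_a + 1 <= f_b] near [+oo] whenever [a < b].  Such a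
    chain exists because every countable family of continuous functions is
    eventually dominated by a continuous function ([tower_exists]).  The new
    surface is separable, as the two planes are dense in it, although it
    contains a long ray.

    The leaves are the level sets of one continuous function, [transverse],
    equal to [expR (- x)] on one plane, [- expR (- x)] on the other and [0] on
    the ray.  The foliation consists of all box charts whose second coordinate
    is, locally, an invertible function of [transverse]; on a level set its
    leaf topology is the topology induced by the surface, so the leaves are
    the level sets as soon as these are connected ([level_componentE]).

    What remains is that the space is a surface, that is, to find charts near
    the ray.  By the intermediate value theorem along the leaves, any
    continuous real function [h] that increases strictly along every leaf (a
    [ruler]) makes [(h, transverse)] an open injection ([ruler_open]), whose
    restrictions are charts.  On the ray a ruler can only be strict below a
    given point [u], since the long ray does not embed in [R].  Below [u] there
    are countably many blocks; each block [a] carries the continuous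
    coordinate equal to [y - f_a x] clamped to [[0, 1]] on the planes and to
    the clamped height above the start of the block on the ray.  The sum of
    these coordinates with weights [2^-n], plus a term that is strictly
    increasing along the vertical lines and vanishes on the ray, is a ruler
    ([tower_ruler]).  The same functions separate points, which gives the
    Hausdorff property.  The surface is connected because [transverse] is open
    with connected fibres. *)

Set Implicit Arguments.
Unset Strict Implicit.
Unset Printing Implicit Defensive.

Import Order.TTheory GRing.Theory Num.Theory.
Import numFieldNormedType.Exports.

Local Open Scope classical_set_scope.
Local Open Scope ring_scope.

(** * Charts from open injections *)

(** All charts of the surface arise from this lemma: continuity of the inverse
    is openness of [f], and [B] may be any subset of the image. *)
Lemma open_injection_homeomorphism (X Y : topologicalType) (W : set X)
    (f : X -> Y) (B : set Y) :
    W !=set0 -> continuous f -> set_inj W f -> open W ->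
    (forall x O, W x -> nbhs x O -> nbhs (f x) (f @` O)) ->
    B `<=` f @` W ->
  homeomorphism_on (W `&` f @^-1` B) B f.
Proof.
move=> [x0 Wx0] fc finj oW fo BW.
pose g y := xget x0 (W `&` f @^-1` [set y]).
have gP y : B y -> W (g y) /\ f (g y) = y.
  move=> /BW[x Wx fxy]; rewrite /g.
  by case: xgetP => [z _ []//|/(_ x)]; case; split.
have gf x : W x -> B (f x) -> g (f x) = x.
  move=> Wx Bfx; have [Wg fg] := gP _ Bfx.
  by apply: finj fg; rewrite inE.
exists g; split.
- split=> [x [Wx Bfx]//|y By]; have [Wg fg] := gP _ By.
  by split=> //; rewrite /preimage/= fg.
- split=> [x|y]; rewrite inE.
  + by move=> [Wx Bfx]; exact: gf.
  + by move=> By; have [] := gP _ By.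
- by apply: continuous_subspaceT => x; exact: fc.
apply/subspace_continuousP => y By O /= Og; have [Wg fg] := gP _ By.
have : nbhs (f (g y)) (f @` (O `&` W)).
  by apply: fo => //; apply: filterI => //; exact: open_nbhs_nbhs.
rewrite fg; apply: filterS => z [x [Ox Wx] <-] Bz.
by change (O (g (f x))); rewrite gf.
Qed.

Lemma pair_continuous (X Y Z : topologicalType) (f : X -> Y) (g : X -> Z) :
  continuous f -> continuous g -> continuous (fun x => (f x, g x)).
Proof.
move=> fc gc x A [[/= B C] [nB nC] BC].
have H : nbhs x (f @^-1` B `&` g @^-1` C).
  by apply: filterI; [exact: fc|exact: gc].
by apply: (@filterS _ (nbhs x) _ _ _ _ H) => y [By Cy]; apply: BC.
Qed.

Lemma matrix_continuous (X Y : topologicalType) m n (f : X -> 'M[Y]_(m, n)) :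
  (forall i j, continuous (fun x => f x i j)) -> continuous f.
Proof.
move=> fc x A [P nP PA].
have H : \forall y \near x, forall i j, P i j (f y i j).
  apply: filter_forall => i; apply: filter_forall => j.
  exact: (fc i j x _ (nP i j)).
by apply: (@filterS _ (nbhs x) _ _ _ _ H) => y Py; apply: PA.
Qed.

Section PlaneModels.
Context (R : realType).

Definition box_of_pair (z : R * R) : R * 'rV[R]_1 := (z.1, const_mx z.2).
Definition pair_of_box (v : R * 'rV[R]_1) : R * R := (v.1, v.2 0 0).
Definition row_of_pair (z : R * R) : 'rV[R]_2 :=
  \row_(i < 2) (if i == 0 then z.1 else z.2).
Definition pair_of_row (v : 'rV[R]_2) : R * R := (v 0 0, v 0 1).

Lemma box_of_pairK : cancel box_of_pair pair_of_box.
Proof. by case=> x y; rewrite /pair_of_box/= mxE. Qed.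

Lemma pair_of_boxK : cancel pair_of_box box_of_pair.
Proof.
case=> x v; congr pair; apply/rowP => i; rewrite mxE ord1; by [].
Qed.

Lemma row_of_pairK : cancel row_of_pair pair_of_row.
Proof. by case=> x y; rewrite /pair_of_row !mxE. Qed.

Lemma pair_of_rowK : cancel pair_of_row row_of_pair.
Proof.
move=> v; apply/rowP => i; rewrite mxE.
by case: i => -[|[|//]] k; congr (v _ _); apply: val_inj.
Qed.

Lemma box_of_pair_continuous : continuous box_of_pair.
Proof.
apply: pair_continuous; first by move=> z; exact: cvg_fst.
apply: matrix_continuous => i j z.
under eq_fun do rewrite mxE. exact: cvg_snd.
Qed.

Lemma pair_of_box_continuous : continuous pair_of_box.
Proof.
apply: pair_continuous; first by move=> z; exact: cvg_fst.
move=> v; apply: (@continuous_comp (R * 'rV[R]_1)%type 'rV[R]_1 R snd (fun M => M 0 0)).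
  exact: cvg_snd.
exact: coord_continuous.
Qed.

Lemma row_of_pair_continuous : continuous row_of_pair.
Proof.
apply: matrix_continuous => i j z; under eq_fun do rewrite mxE.
by case: ifP => _; [exact: cvg_fst|exact: cvg_snd].
Qed.

Lemma pair_of_row_continuous : continuous pair_of_row.
Proof. by apply: pair_continuous; exact: coord_continuous. Qed.

End PlaneModels.

Lemma nbhs_push (X Y : topologicalType) (j : X -> Y) (k : Y -> X) x (S : set X) :
  continuous k -> cancel j k -> cancel k j -> nbhs x S -> nbhs (j x) (j @` S).
Proof.
move=> kc jK kK nS; have := kc (j x); rewrite /continuous_at jK => /(_ _ nS) H.
by apply: (@filterS _ (nbhs (j x)) _ _ _ _ H) => y Sy; exists (k y).
Qed.

(** * Foliations by the level sets of a function *)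

Section LevelFoliation.
Context (R : realType) (M : topologicalType) (w : M -> R).

(** Locally, [w] and the second coordinate of the chart are functions of each
    other; composing these functions for two straight charts gives the transverse
    part of their coordinate change. *)
Definition straight (c : chart R 2 M) (p : M) :=
  exists (g : R -> 'rV[R]_1) (g' : 'rV[R]_1 -> R),
    \forall q \near p, (c.2 q).2 = g (w q) /\ w q = g' (c.2 q).2.

Definition straight_atlas : set (chart R 2 M) :=
  [set c | box_chart c /\ forall p, c.1 p -> straight c p].

(** The first component of a coordinate change is unconstrained: since a chart
    is injective, it is always some function of the chart. *)
Lemma foliated_changeP (c c' : chart R 2 M) : box_chart c ->
  foliated_change c c' <-> forall p, (c.1 `&` c'.1) p ->
    exists g : 'rV[R]_1 -> 'rV[R]_1, \forall q \near p, (c'.2 q).2 = g (c.2 q).2.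
Proof.
move=> [oc [B _ [k [_ [ck _] _ _]]]]; split=> H p pcc'.
  have [f [g fg]] := H _ pcc'; exists g.
  by apply: filterS fg => q ->.
have [g gP] := H _ pcc'; exists (fun z => (c'.2 (k z)).1), g.
have cp : nbhs p c.1 by apply: open_nbhs_nbhs; split=> //; case: pcc'.
near=> q.
have cq : c.1 q by near: q.
rewrite ck ?inE//; have <- : (c'.2 q).2 = g (c.2 q).2 by near: q.
exact: surjective_pairing.
Unshelve. all: by end_near. Qed.

Lemma straight_change (c c' : chart R 2 M) :
  straight_atlas c -> straight_atlas c' -> foliated_change c c'.
Proof.
move=> [bc sc] [bc' sc']; apply/foliated_changeP => // p [cp c'p].
have [g [g' gP]] := sc _ cp; have [h [h' hP]] := sc' _ c'p.
exists (h \o g'); near=> q.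
have [_ E] : (c.2 q).2 = g (w q) /\ w q = g' (c.2 q).2 by near: q.
have [E' _] : (c'.2 q).2 = h (w q) /\ w q = h' (c'.2 q).2 by near: q.
by rewrite E' E.
Unshelve. all: by end_near. Qed.

Hypothesis wcover : forall p, exists2 c, straight_atlas c &
  c.1 p /\ forall q, c.1 q -> (c.2 q).2 = const_mx (w q).

(** Compatibility with one chart around [p] whose transverse coordinate is [w]
    itself already forces a chart to be straight at [p]. *)
Lemma straight_maximal (c : chart R 2 M) : box_chart c ->
    (forall c', straight_atlas c' -> foliated_change c c' /\ foliated_change c' c) ->
  straight_atlas c.
Proof.
move=> bc H; split=> // p cp; have [c' ac' [c'p c'w]] := wcover p.
have [/(foliated_changeP _ bc) cc' /(foliated_changeP _ (proj1 ac')) c'c] := H _ ac'.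
have [g gP] := c'c _ (conj c'p cp); have [h hP] := cc' _ (conj cp c'p).
exists (fun t => g (const_mx t)), (fun v => h v 0 0).
have nc' : nbhs p c'.1 by apply: open_nbhs_nbhs; split=> //; case: ac' => -[].
near=> q.
have cq : c'.1 q by near: q.
have Eg : (c.2 q).2 = g (c'.2 q).2 by near: q.
have Eh : (c'.2 q).2 = h (c.2 q).2 by near: q.
by rewrite -Eh Eg c'w// mxE.
Unshelve. all: by end_near. Qed.

Lemma straight_cover p : exists2 c, straight_atlas c & c.1 p.
Proof. by have [c ac [cp _]] := wcover p; exists c. Qed.

Definition level_foliation : foliation R 2 M :=
  Foliation (fun c => @proj1 _ _) straight_cover straight_change straight_maximal.

Local Notation F := level_foliation.
Local Notation to_leaf := (fun p : M => p : leaf_space F).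
Local Notation of_leaf := (fun p : leaf_space F => p : M).

Lemma leaf_space_subbase (A : set (leaf_space F)) : open_in_plaque F A -> open A.
Proof.
move=> PA; exists [set A]; last by rewrite bigcup_set1.
move=> B ->; exists [fset A]%fset; last by rewrite set_fset1 bigcap_set1.
by move=> C /fset1P ->; exact/mem_set.
Qed.

Lemma leaf_topology_finer : continuous of_leaf.
Proof.
apply/continuousP => O oO.
rewrite openE => p Op; have [c ac cp] := straight_cover p.
exists (O `&` (c.1 `&` [set q | (c.2 q).2 = (c.2 p).2])); split.
- apply: leaf_space_subbase.
  exists (c.1 `&` [set q | (c.2 q).2 = (c.2 p).2]); last by exists O.
  by exists c => //; exists (c.2 p).2.
- by split.
- by move=> q [].
Qed.

Lemma level_leaf_open a : open (w @^-1` [set a] : set (leaf_space F)).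
Proof.
rewrite openE => p pa; have [c ac [cp cw]] := wcover p.
exists (c.1 `&` [set q | (c.2 q).2 = const_mx (w p)]); split.
- apply: leaf_space_subbase.
  exists (c.1 `&` [set q | (c.2 q).2 = const_mx (w p)]).
    by exists c => //; exists (const_mx (w p)).
  by exists setT; [exact: openT|rewrite setTI].
- by split=> //; rewrite /= cw.
- move=> q [cq /=]; rewrite cw// => /matrixP/(_ 0 0).
  by rewrite !mxE => ->.
Qed.

Lemma level_leaf_closed a : closed (w @^-1` [set a] : set (leaf_space F)).
Proof.
rewrite -openC openE => p pa.
exists (w @^-1` [set w p]); split=> //; first exact: level_leaf_open.
by move=> q /= ->.
Qed.

(** Near a point of a plaque, the plaque contains every nearby point of the same
    level set, because the second coordinate of a straight chart is locally a
    function of [w].  So plaques cut out open subsets of the level set. *)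
Lemma leaf_topology_on_level a : {within w @^-1` [set a], continuous to_leaf}.
Proof.
apply/subspace_continuousP => p pa V /=.
case=> ? [[I Irp] <-] [J IJ Jp] IV.
have [S SF JE] := Irp _ IJ.
suff : @nbhs M M p (fun q => w q = a -> J q).
  apply: (@filterS M (@nbhs M M p)) => q Jq qa; apply: IV.
  by exists J => //; exact: Jq.
suff : @nbhs M M p (\bigcap_(A in [set` S]) [set q | w q = a -> A q]).
  apply: (@filterS M (@nbhs M M p)) => q Jq qa; rewrite -JE => A AS.
  exact: Jq.
apply: (@filter_bigI M _ _ _ (@nbhs M M p)) => A AS.
have /set_mem[_ [c [bc sc] [y ->]] [U oU AE]] := SF _ AS.
have : (J : set M) p by [].
rewrite -JE => /(_ _ AS) Ap; have {Ap} : (A : set M) p by [].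
rewrite AE => -[Up [cp cpy]].
have [g [g' gP]] := sc _ cp.
have nU : nbhs p U by apply: open_nbhs_nbhs.
have nc : nbhs p c.1 by apply: open_nbhs_nbhs; split => //; case: bc.
have gp := nbhs_singleton gP.
near=> q; move=> qa; split; first by near: q.
split; first by near: q.
have [cq _] : (c.2 q).2 = g (w q) /\ w q = g' (c.2 q).2 by near: q.
by rewrite /= cq qa -pa -gp.1.
Unshelve. all: by end_near. Qed.

Lemma level_connected a : connected (w @^-1` [set a]) ->
  connected (w @^-1` [set a] : set (leaf_space F)).
Proof.
move=> /connected_continuous_connected/(_ (@leaf_topology_on_level a)).
by rewrite image_id.
Qed.

Hypothesis wconn : forall a, connected (w @^-1` [set a]).

(** A level set is clopen for the leaf topology, being covered by the plaques of
    the charts with transverse coordinate [w]. *)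
Lemma level_componentE p :
  connected_component [set: leaf_space F] p = w @^-1` [set w p].
Proof.
rewrite eqEsubset; split; last first.
  by apply: connected_component_max => //; exact/level_connected/wconn.
move=> q [A [Ap _ cA]] Aq.
suff AE : A = A `&` (w @^-1` [set w p]) by move: Aq; rewrite AE => -[].
apply/esym; apply: cA.
- by exists p.
- by exists (w @^-1` [set w p]) => //; exact: level_leaf_open.
- by exists (w @^-1` [set w p]) => //; exact: level_leaf_closed.
Qed.

Lemma level_homeomorphic (Y : topologicalType) (B : set Y) a :
  homeomorphic (w @^-1` [set a]) B ->
  homeomorphic (w @^-1` [set a] : set (leaf_space F)) B.
Proof.
move=> [f [g [[fAB gBA] [fK gK] fc gc]]].
exists (f \o of_leaf), (to_leaf \o g); split=> //.
- apply/subspace_continuousP => p pa.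
  move/subspace_continuousP : fc => /(_ _ pa) fc.
  apply: cvg_trans fc; apply: cvg_app => V VA.
  exact: (@leaf_topology_finer p).
apply/subspace_continuousP => y By.
move/subspace_continuousP : gc => /(_ _ By) gc.
move/subspace_continuousP : (@leaf_topology_on_level a) => /(_ _ (gBA _ By)) tc.
move=> V nV; have H := gc _ (tc _ nV).
suff : nbhs y (fun z => B z -> V (g z)) by [].
apply: (@filterS Y (@nbhs Y Y y) _ _ _ _ H) => z zV Bz. exact: zV Bz (gBA _ Bz).
Qed.

End LevelFoliation.

(** * Orders with lexicographic coordinates *)

Section OrderContinuum.
Context d (T : orderTopologicalType d) (o : T).

Hypothesis above : forall t : T, exists u, (t < u)%O.
Hypothesis between : forall s t : T, (s < t)%O -> exists2 m, (s < m)%O & (m < t)%O.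
Hypothesis cut : forall (A : set T) u,
  (forall s t, (s < t)%O -> A t -> A s) -> ~ A u ->
  exists c, (forall s, (s < c)%O -> A s) /\ (forall t, (c < t)%O -> ~ A t).

Lemma open_ray_nbhs (c : T) (U : set T) : (o < c)%O -> nbhs c U ->
  exists s u, [/\ (s < c)%O, (c < u)%O & forall t, (s < t)%O -> (t < u)%O -> U t].
Proof.
move=> c0; rewrite itv_nbhsE => -[[l r] [lro]].
rewrite inE/= => /andP[cl cr] lrU.
have [u0 cu0] := above c.
have [s [sc sl]] : exists s, (s < c)%O /\
    forall t, (s < t)%O -> (l <= BLeft t)%O.
  case: l lro cl {cr lrU} => [[] x|[]] lro cl.
  - by case: r lro => [[]?|[]].
  - by exists x; split.
  - by exists o; split.
  - by [].
have [u [cu ur]] : exists u, (c < u)%O /\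
    forall t, (t < u)%O -> (BRight t <= r)%O.
  case: r lro cr {cl lrU sl} => [[] x|[]] lro cr.
  - by exists x; split.
  - by case: l lro => [[]?|[]].
  - by [].
  - by exists u0; split.
exists s, u; split=> // t st tu; apply: lrU => /=.
by rewrite inE; apply/andP; split; [exact: sl|exact: ur].
Qed.

Let open_ray_meet (U V : set T) a b : open U -> open V ->
    [set t | (o < t)%O] `<=` U `|` V -> (o < a)%O -> (a < b)%O -> U a -> V b ->
  exists2 c, (o < c)%O & U c /\ V c.
Proof.
move=> oU oV UV a0 ab Ua Vb; apply: contrapT => H.
have disj c : (a <= c)%O -> U c -> V c -> False.
  by move=> ac Uc Vc; apply: H; exists c => //; exact: lt_le_trans ac.
have [c [cS Sc]] : exists c,
    (forall s, (s < c)%O -> forall r, (a <= r <= s)%O -> U r) /\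
    (forall t, (c < t)%O -> ~ forall r, (a <= r <= t)%O -> U r).
  (* The cut [c] is the end of the longest interval of [U] that starts at [a].
     If [c] is in [U], this interval extends beyond [c]; if [c] is in [V], then
     [V] meets the interval just before [c]. *)
  apply: (@cut (fun s => forall r, (a <= r <= s)%O -> U r) b)
    => [s t st tU r /andP[ar rs]|bU].
    by apply: tU; rewrite ar/= (le_trans rs)// ltW.
  by apply: (disj b) => //; rewrite ?(ltW ab)//; apply: bU; rewrite (ltW ab) lexx.
have ac : (a <= c)%O.
  rewrite leNgt; apply/negP => ca; apply: (Sc _ ca) => r.
  by rewrite -eq_le => /eqP <-.
have c0 : (o < c)%O by exact: lt_le_trans ac.
have [Uc|Vc] := UV _ c0.
- have [s [u [sc cu suU]]] := open_ray_nbhs c0 (open_nbhs_nbhs (conj oU Uc)).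
  have [m cm mu] := between cu.
  apply: (Sc _ cm) => r /andP[ar rm].
  have [rc|cr|->//] := ltgtP r c.
    by apply: (cS r rc); rewrite ar lexx.
  by apply: suU; [exact: lt_trans cr|exact: le_lt_trans mu].
- have {ac} ac : (a < c)%O.
    by rewrite lt_neqAle ac andbT; apply/eqP => E; apply: (disj a) => //; rewrite E.
  have [s [u [sc cu suV]]] := open_ray_nbhs c0 (open_nbhs_nbhs (conj oV Vc)).
  have [m] : exists2 m, (Order.max a s < m)%O & (m < c)%O.
    by apply: between; rewrite gt_max ac sc.
  rewrite gt_max => /andP[am sm] mc.
  apply: (disj m); first exact: ltW.
  - by apply: (cS _ mc); rewrite (ltW am) lexx.
  - by apply: suV => //; exact: lt_trans cu.
Qed.

(** An order without gaps and jumps is connected.  The hypotheses are stated for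
    cuts by arbitrary lower sets, since this is the form of completeness that a
    well-ordered family of unit intervals provides. *)
Lemma open_ray_connected : connected ([set t | (o < t)%O]).
Proof.
move=> B [b Bb] [C oC BC] [D cD BD].
rewrite eqEsubset; split=> [x|t At]; first by rewrite BC => -[].
apply: contrapT => nBt.
have [Ab Cb] : ([set t | (o < t)%O] `&` C) b by rewrite -BC.
have Dt : (~` D) t by move=> Dt; apply: nBt; rewrite BD.
have cov x : (o < x)%O -> C x \/ (~` D) x.
  move=> Ax; have [Dx|] := pselect (D x); last by right.
  by left; have : B x by [rewrite BD]; rewrite BC => -[].
have disj x : (o < x)%O -> C x -> (~` D) x -> False.
  by move=> Ax Cx; apply; have : B x by [rewrite BC]; rewrite BD => -[].
have oD : open (~` D) by rewrite openC.
have [bt|tb|E] := ltgtP b t.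
- have [c Ac [Cc Dc]] := @open_ray_meet C (~` D) b t oC oD cov
    Ab bt Cb Dt.
  exact: (disj c).
- have cov' : [set t | (o < t)%O] `<=` ~` D `|` C by move=> x /cov[]; [right|left].
  have [c Ac [Dc Cc]] := @open_ray_meet (~` D) C t b oD oC cov'
    At tb Dt Cb.
  exact: (disj c).
- by apply: nBt; rewrite -E.
Qed.

End OrderContinuum.

(** The long ray seen through its coordinates, a block in [omega1] and a height
    in [[0, 1)].  Completeness, density and the construction of the surface use
    nothing else of it. *)
Record lex_coords (R : realType) d (T : orderTopologicalType d) := LexCoords {
  lex_block : T -> omega1;
  lex_height : T -> R;
  lex_point : omega1 -> R -> T;
  lex_height01 : forall t, 0 <= lex_height t < 1;
  lex_block_point : forall a r, 0 <= r < 1 -> lex_block (lex_point a r) = a;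
  lex_height_point : forall a r, 0 <= r < 1 -> lex_height (lex_point a r) = r;
  lex_ltP : forall s t, reflect
    ((lex_block s < lex_block t)%O \/
     lex_block s = lex_block t /\ lex_height s < lex_height t) (s < t)%O }.

Section LexCoords.
Context (R : realType) d (T : orderTopologicalType d) (k : lex_coords R T).
Local Notation block := (lex_block k).
Local Notation height := (lex_height k).
Local Notation point := (lex_point k).
Local Notation ltP := (lex_ltP k).

Lemma height_ge0 t : 0 <= height t.
Proof. by have /andP[] := lex_height01 k t. Qed.

Lemma height_lt1 t : height t < 1.
Proof. by have /andP[] := lex_height01 k t. Qed.

Lemma lex_pointK t : point (block t) (height t) = t.
Proof.
have t01 := lex_height01 k t.
have [/ltP|/ltP|//] := ltgtP (point (block t) (height t)) t;
  by rewrite lex_block_point// lex_height_point// !ltxx => -[|[]].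
Qed.

Lemma lex_above (t : T) : exists u, (t < u)%O.
Proof.
have h0 := height_ge0 t; have h1 := height_lt1 t.
have r01 : 0 <= (height t + 1) / 2 < 1 by lra.
exists (point (block t) ((height t + 1) / 2)).
by apply/ltP; right; rewrite lex_block_point// lex_height_point//; split=> //; lra.
Qed.

Lemma lex_between (s t : T) : (s < t)%O -> exists2 m, (s < m)%O & (m < t)%O.
Proof.
have s0 := height_ge0 s; have s1 := height_lt1 s; have t1 := height_lt1 t.
case/ltP => [st|[E st]].
  have r01 : 0 <= (height s + 1) / 2 < 1 by lra.
  exists (point (block s) ((height s + 1) / 2)); apply/ltP;
    rewrite lex_block_point// lex_height_point//; [right|by left].
  by split=> //; lra.
have r01 : 0 <= (height s + height t) / 2 < 1 by lra.
exists (point (block s) ((height s + height t) / 2)); apply/ltP; right;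
  by rewrite lex_block_point// lex_height_point//; split=> //; lra.
Qed.

(** The cut lies in the first block not contained in [A]: at its starting point,
    or else at the supremum of the heights of the points of [A] in that block. *)
Lemma lex_cut (A : set T) u : (forall s t, (s < t)%O -> A t -> A s) -> ~ A u ->
  exists c, (forall s, (s < c)%O -> A s) /\ (forall t, (c < t)%O -> ~ A t).
Proof.
move=> dA nAu.
have [a [t [ta nAt]] amin] := @omega1_min [set a | exists t : T, block t = a /\ ~ A t]
  (ex_intro _ (block u) (ex_intro _ u (conj erefl nAu))).
have below s : (block s < a)%O -> A s.
  by move=> sa; apply: contrapT => nAs; move: sa; rewrite ltNge amin//; exists s.
have r0 : 0 <= (0 : R) < 1 by rewrite lexx ltr01.
have [A0|nA0] := pselect (A (point a 0)); last first.
  exists (point a 0); split=> [s|v av Av]; last exact/nA0/(dA _ _ av).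
  case/ltP => [|[_]]; first by rewrite lex_block_point//; exact: below.
  by rewrite lex_height_point// ltNge height_ge0.
pose S := [set r | 0 <= r < 1 /\ A (point a r)].
have S0 : S 0 by split.
have Sub : ubound S (height t).
  move=> r [r01 Ar]; rewrite leNgt; apply/negP => tr; apply: nAt.
  apply: (dA _ (point a r)) => //; apply/ltP; right.
  by rewrite lex_block_point// lex_height_point.
have supS : has_sup S by split; [exists 0 | exists (height t)].
have s0 : 0 <= sup S by apply: sup_upper_bound.
have s1 : sup S < 1.
  by apply: le_lt_trans (height_lt1 t); apply: ge_sup => //; exists 0.
have s01 : 0 <= sup S < 1 by rewrite s0.
exists (point a (sup S)); split=> [s|v] /ltP; rewrite lex_height_point// lex_block_point//.
  case=> [|[sa]]; first exact: below.
  move=> /sup_gt[|r [r01 Ar] sr]; first by exists 0.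
  by apply: dA Ar; apply/ltP; right; rewrite lex_block_point// lex_height_point.
move=> + Av; case=> [av|[va]].
  by apply: nAt; apply: dA Av; apply/ltP; left; rewrite ta.
rewrite ltNge sup_upper_bound//; split; first exact: lex_height01.
by rewrite va lex_pointK.
Qed.

Lemma lex_ray_connected (o : T) : connected [set t | (o < t)%O].
Proof.
apply: open_ray_connected => [t|s t st|A u dA nAu].
- exact: lex_above.
- exact: lex_between.
- exact: lex_cut dA nAu.
Qed.

End LexCoords.

(** * Weighted sums of functions *)

Section WeightedSum.
Context (R : realType) (X : topologicalType) (g : nat -> X -> R).
Hypothesis gc : forall n, continuous (g n).
Hypothesis g01 : forall n x, 0 <= g n x <= 1.

Let S n x : R := \sum_(0 <= k < n) g k x / 2 ^+ k.

Let S_cont n : continuous (S n).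
Proof.
elim: n => [|n IH] x.
  by rewrite /S; under eq_fun do rewrite big_geq//; exact: cvg_cst.
rewrite /S; under eq_fun do rewrite big_nat_recr//=.
apply: (@continuousD _ _ _ (S n) (fun x => g n x / 2 ^+ n)); first exact: IH.
apply: (@continuousM _ _ (g n) (cst (2 ^+ n)^-1)); first exact: gc.
exact: cvg_cst.
Qed.

Let S_mono m n x : (m <= n)%N -> S m x <= S n x.
Proof.
move=> mn; rewrite /S (big_cat_nat (leq0n m) mn)/= lerDl sumr_ge0// => k _.
by rewrite divr_ge0// ?exprn_ge0//; have /andP[] := g01 k x.
Qed.

Let S_tail m n x : S n x <= S m x + 2 / 2 ^+ m.
Proof.
have [nm|mn] := leqP n m.
  by apply: le_trans (S_mono x nm) _; rewrite lerDl divr_ge0// exprn_ge0.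
suff : S n x + 2 / 2 ^+ n <= S m x + 2 / 2 ^+ m.
  by apply: le_trans; rewrite lerDl divr_ge0// exprn_ge0.
rewrite -(subnKC (ltnW mn)); elim: (n - m)%N => [|k IH]; first by rewrite addn0.
apply: le_trans IH; rewrite addnS /S big_nat_recr//= -addrA lerD2l.
have -> : 2 / 2 ^+ (m + k).+1 = (2 ^+ (m + k))^-1 :> R.
  by rewrite exprS invfM mulrA divff// mul1r.
rewrite -[X in _ + X]mul1r -mulrDl ler_wpM2r// ?invr_ge0 ?exprn_ge0//.
by have /andP[_] := g01 (m + k) x; lra.
Qed.

Let H x := sup (range (S^~ x)).

Let S_ub x : has_ubound (range (S^~ x)).
Proof.
by exists (S 0 x + 2 / 2 ^+ 0) => _ [n _ <-]; exact: S_tail.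
Qed.

Let S_le n x : S n x <= H x.
Proof. by apply: ub_le_sup => //; exists n. Qed.

Let H_le n x : H x <= S n x + 2 / 2 ^+ n.
Proof. by apply: ge_sup => [|_ [k _ <-]]; [exists (S 0 x), 0%N|exact: S_tail]. Qed.

Let H_cont : continuous H.
Proof.
move=> x; apply/cvgrPdist_lt => e e0.
have [n ne] : exists n, 2 / 2 ^+ n < e / 2 :> R.
  have e4 : 0 < e / 4 by rewrite divr_gt0.
  have : (2^-1 : R) ^+ n @[n --> \oo] --> 0.
    by apply: cvg_expr; rewrite ger0_norm; lra.
  move/cvgrPdist_lt => /(_ _ e4)[n _ /(_ n (leqnn n))].
  rewrite sub0r normrN ger0_norm ?exprn_ge0// exprVn => h; exists n.
  by move: h; set t := (2 ^+ n)^-1; lra.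
have e2 : 0 < e / 2 by rewrite divr_gt0.
have := @S_cont n x; move/cvgrPdist_lt => /(_ _ e2).
apply: filterS => y; rewrite !ltr_norml => /andP[].
have := S_le n x; have := H_le n x; have := S_le n y; have := H_le n y.
by move: ne; set t := _ / 2 ^+ n => *; apply/andP; split; lra.
Qed.

(** The sum of the [g n / 2 ^ n], of which only continuity and monotonicity
    matter: comparing two points on all the [g n] compares the sums, strictly
    if one comparison is strict. *)
Lemma weighted_sum : exists h : X -> R, [/\ continuous h,
  forall x y, (forall n, g n x <= g n y) -> h x <= h y &
  forall x y, (forall n, g n x <= g n y) -> (exists n, g n x < g n y) ->
    h x < h y].
Proof.
have S_diff k x y n : (forall n, g n x <= g n y) -> (k < n)%N ->
    S n x + (g k y - g k x) / 2 ^+ k <= S n y.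
  move=> gxy kn; rewrite /S -lerBrDl -sumrB.
  rewrite (bigD1_seq k) ?mem_index_iota ?iota_uniq//=.
  rewrite -mulrBl lerDl sumr_ge0// => i _.
  by rewrite -mulrBl divr_ge0 ?exprn_ge0// subr_ge0.
exists H; split=> [|x y gxy|x y gxy [k gk]]; first exact: H_cont.
  apply: ge_sup => [|_ [n _ <-]]; first by exists (S 0 x), 0%N.
  apply: le_trans (S_le n y); apply: ler_sum => k _.
  by rewrite ler_wpM2r// invr_ge0 exprn_ge0.
have d0 : 0 < (g k y - g k x) / 2 ^+ k by rewrite divr_gt0 ?exprn_gt0// subr_gt0.
suff : H x <= H y - (g k y - g k x) / 2 ^+ k by lra.
apply: ge_sup => [|_ [n _ <-]]; first by exists (S 0 x), 0%N.
apply: le_trans (S_mono x (leq_maxl n k.+1)) _.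
rewrite lerBrDr; apply: le_trans (S_le (maxn n k.+1) y).
by apply: S_diff => //; rewrite leq_max leqnn orbT.
Qed.

End WeightedSum.

(** * Towers of functions *)

Section Towers.
Context (R : realType).

Definition clamp (z : R) : R := Num.max 0 (Num.min 1 z).

Lemma clamp_continuous : continuous clamp.
Proof.
have H : continuous (cst 0 \max (cst 1 \min id) : R -> R).
  apply: max_fun_continuous; first by move=> x; exact: cvg_cst.
  apply: min_fun_continuous; first by move=> x; exact: cvg_cst.
  by move=> x; exact: cvg_id.
exact: H.
Qed.

Lemma clamp01 z : 0 <= clamp z <= 1.
Proof. by rewrite /clamp le_max lexx/= ge_max ler01 ge_min lexx. Qed.

Lemma clamp0 z : z <= 0 -> clamp z = 0.
Proof. by move=> z0; rewrite /clamp max_l// ge_min z0 orbT. Qed.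

Lemma clamp1 z : 1 <= z -> clamp z = 1.
Proof. by move=> z1; rewrite /clamp min_l// max_r. Qed.

Lemma clampid z : 0 <= z <= 1 -> clamp z = z.
Proof. by move=> /andP[z0 z1]; rewrite /clamp min_r// max_r. Qed.

Lemma clamp_le z z' : z <= z' -> clamp z <= clamp z'.
Proof.
move=> zz'; have /andP[h0 _] := clamp01 z'; have /andP[_ h1] := clamp01 z.
have [z0|z0] := leP z 0; first by rewrite clamp0.
have [z1|z1] := leP 1 z'; first by rewrite (clamp1 z1).
by rewrite !clampid//; lra.
Qed.

(** Domination by at least [1] leaves room, between [f_a] and the later
    functions, for the curves [f_a + r] with [r < 1] that converge to the points
    of the block [a]. *)
Record tower := Tower {
  tower_fun :> omega1 -> R -> R;
  tower_cont : forall a, continuous (tower_fun a);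
  tower_lt : forall a b, (a < b)%O ->
    \forall x \near +oo, tower_fun a x + 1 <= tower_fun b x }.

(** The [n]-th summand of the dominating function is switched on continuously
    between [n] and [n + 1], so the sum is locally finite. *)
Lemma dominate_seq (f : nat -> R -> R) : (forall n, continuous (f n)) ->
  exists2 g : R -> R, continuous g &
    forall n, \forall x \near +oo, f n x <= g x.
Proof.
move=> fc.
pose c n x := clamp (x - n%:R) * `|f n x|.
have c_cont n : continuous (c n).
  move=> x; rewrite /c.
  apply: (@continuousM R R (fun x => clamp (x - n%:R)) (fun x => `|f n x|) x).
    apply: (@continuous_comp R R R (fun x => x - n%:R) clamp x); last exact: clamp_continuous.
    by apply: continuousB; [exact: cvg_id|exact: cvg_cst].
  by apply: (@continuous_comp R R R (f n) Num.norm x); [exact: fc|exact: norm_continuous].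
have c0 n x : 0 <= c n x by rewrite mulr_ge0//; have /andP[] := clamp01 (x - n%:R).
have c00 n x : x <= n%:R -> c n x = 0.
  move=> xn; rewrite /c clamp0 ?mul0r//; lra.
pose G K x := \sum_(0 <= n < K) c n x.
have G_cont K : continuous (G K).
  elim: K => [|K IH] x.
    by rewrite /G; under eq_fun do rewrite big_geq//; exact: cvg_cst.
  rewrite /G; under eq_fun do rewrite big_nat_recr//=.
  by apply: (@continuousD _ _ _ (G K) (c K)); [exact: IH|exact: c_cont].
have G_eq K L x : (K <= L)%N -> x <= K%:R -> G L x = G K x.
  move=> KL xK; rewrite /G (big_cat_nat (leq0n K) KL)/= [X in _ + X]big_nat.
  rewrite [X in _ + X]big1 ?addr0// => n /andP[Kn _].
  by apply: c00; apply: le_trans xK _; rewrite ler_nat.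
pose B (x : R) := Num.Def.archi_bound `|x|.
have xB x : x <= (B x)%:R.
  by apply: le_trans (ler_norm x) _; apply: ltW; exact: archi_boundP.
have GB K x : x <= K%:R -> G (B x) x = G K x.
  move=> xK; have [BK|KB] := leqP (B x) K; first by rewrite [RHS](G_eq _ _ _ BK).
  by rewrite (G_eq K)// ltnW.
exists (fun x => G (B x) x).
  move=> x.
  have nE : \forall y \near x, G (B (x + 1)) y = G (B y) y.
    near=> y; rewrite (GB (B (x + 1)))//.
    apply: le_trans (xB (x + 1)).
    near: y; apply: (cvgr_le x) => //; lra.
  have E : G (B x) x = G (B (x + 1)) x by apply: GB; apply: le_trans (xB _); lra.
  rewrite /continuous_at E.
  apply: cvg_trans (@G_cont (B (x + 1)) x); apply: near_eq_cvg.
  by apply: filterS nE => y ->.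
move=> n; near=> x.
rewrite -[G _ x](G_eq _ (maxn (B x) n.+1))// ?leq_maxl//.
rewrite /G (bigD1_seq n) ?mem_index_iota ?iota_uniq//=; last by rewrite leq_max leqnn orbT.
apply: (@le_trans _ _ (c n x)); last by rewrite lerDl sumr_ge0.
have xn : n%:R + 1 <= x by near: x; exact: nbhs_pinfty_ge.
rewrite /c clamp1 ?mul1r ?ler_norm//; lra.
Unshelve. all: by end_near. Qed.

Lemma dominate_countable (A : set (R -> R)) : countable A ->
  (forall f, A f -> continuous f) ->
  exists2 g : R -> R, continuous g &
    forall f, A f -> \forall x \near +oo, f x + 1 <= g x.
Proof.
move=> /pcard_injP[e einj] Ac.
pose f n := xget (cst 0) [set f | A f /\ e f = n].
have fE h : A h -> f (e h) = h.
  move=> Ah; rewrite /f; case: xgetP => [k _ [Ak ek]|/(_ h)]; last by case.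
  by apply: einj; rewrite ?inE.
have fc n : continuous (fun x => f n x + 1).
  move=> x; apply: continuousD; last exact: cvg_cst.
  rewrite /f; case: xgetP => [k _ [/Ac Ak _]|_]; [exact: Ak|exact: cvg_cst].
have [g gc gP] := dominate_seq fc; exists g => // h Ah.
by have := gP (e h); rewrite fE.
Qed.

Lemma omega1_wf : well_founded (fun a b : omega1 => (a < b)%O).
Proof.
move=> a; apply: contrapT => na.
have [m nm mle] := @omega1_min [set a | ~ Acc (fun a b : omega1 => (a < b)%O) a]
  (ex_intro _ a na).
apply: nm; constructor => b bm; apply: contrapT => nb.
by move: bm; rewrite ltNge mle.
Qed.

(** Transfinite recursion on [omega1]: only countably many functions precede
    each stage. *)
Lemma tower_exists : inhabited tower.
Proof.
(* The default [cst 0] is never reached: a good function exists at each stage. *)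
pose good a (rec : forall b : omega1, (b < a)%O -> R -> R) (g : R -> R) :=
  continuous g /\ forall b (ba : (b < a)%O), \forall x \near +oo, rec b ba x + 1 <= g x.
pose step a rec := xget (cst 0 : R -> R) [set g | @good a rec g].
pose f := Fix omega1_wf (fun=> R -> R) step.
have fE a : f a = step a (fun b _ => f b).
  rewrite /f Fix_eq// => b r r' rr'; congr step.
  by apply: functional_extensionality_dep => c; apply: functional_extensionality_dep => h.
suff fP a : good a (fun b _ => f b) (f a).
  constructor; apply: (@Tower f) => [a|a b ab]; first by have [] := fP a.
  by have [_] := fP b; exact.
elim/(well_founded_ind omega1_wf): a => a IH.
rewrite fE; apply: xgetPex.
have [|h [b ba <-]|g gc gP] := @dominate_countable (f @` [set b | (b < a)%O]).
- by apply: sub_countable (omega1_countable a); exact: card_image_le.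
- by have [] := IH _ ba.
by exists g; split=> // b ba; apply: gP; exists b.
Qed.

End Towers.

(** * The surface of a family of curves *)

(** For each [t] a curve [y = c t x] in the plane, eventually above the curves
    of all smaller indices; the curve converges, as [x] tends to [+oo], to the
    point [t] that is added to the plane. *)
Record curve_family (R : realType) d (T : orderTopologicalType d) := CurveFamily {
  curve :> T -> R -> R;
  curve_cont : forall t, continuous (curve t);
  curve_above : forall t : T, exists u, (t < u)%O;
  curve_lt : forall s t, (s < t)%O -> \forall x \near +oo, curve s x < curve t x }.

(** Two planes glued along the ray of the indices above [o].  The index [o]
    itself gives no point: its curve only bounds the neighbourhoods of the
    points at the beginning of the ray. *)
Definition ray_surface (R : realType) d (T : orderTopologicalType d) (o : T)
  (c : curve_family R T) : Type := (bool * (R * R) + {t : T | (o < t)%O})%type.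

Section Surf.
Context (R : realType) d (T : orderTopologicalType d) (o : T)
  (c : curve_family R T).
Local Notation M := (ray_surface o c).

HB.instance Definition _ := Choice.on M.

Definition plane_pt b (x y : R) : M := inl (b, (x, y)).

(** A basic neighbourhood of the points [t] of the ray with [s < t < u]. *)
Definition strip s u N : set M := fun q =>
  match q with
  | inl (_, (x, y)) => N < x /\ c s x < y < c u x
  | inr t => (s < val t < u)%O
  end.

Definition ray_surface_open (O : set M) :=
  (forall b, open [set z : R * R | O (inl (b, z))]) /\
  forall t, O (inr t) ->
    exists s u N, [/\ (s < val t)%O, (val t < u)%O & strip s u N `<=` O].

Lemma curve_le s t : (s <= t)%O -> \forall x \near +oo, c s x <= c t x.
Proof.
rewrite le_eqVlt => /predU1P[->|/(curve_lt c)]; first by near=> x.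
by apply: filterS => x /ltW.
Unshelve. all: by end_near. Qed.

Lemma pinfty_from (P : set R) : (\forall x \near +oo, P x) ->
  exists N, forall x, N < x -> P x.
Proof. by move=> [N [_ NP]]; exists N. Qed.

(** The curves of [Order.max s s'] and [Order.min u u'] are only eventually
    between the curves of the two strips, hence the new abscissa [N2]. *)
Lemma stripI t s u N s' u' N' : (s < t < u)%O -> (s' < t < u')%O ->
  exists s2 u2 N2, [/\ (s2 < t)%O, (t < u2)%O &
    strip s2 u2 N2 `<=` strip s u N `&` strip s' u' N'].
Proof.
move=> /andP[st tu] /andP[st' tu'].
exists (Order.max s s'), (Order.min u u').
have [K KP] : exists K, forall x, K < x ->
    [/\ N < x, N' < x, c s x <= c (Order.max s s') x &
      [/\ c s' x <= c (Order.max s s') x, c (Order.min u u') x <= c u x &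
        c (Order.min u u') x <= c u' x]].
  apply: pinfty_from; near=> x; split; [| | |split]; near: x.
  - exact/nbhs_pinfty_gt/num_real.
  - exact/nbhs_pinfty_gt/num_real.
  - by apply: curve_le; rewrite le_max lexx.
  - by apply: curve_le; rewrite le_max lexx orbT.
  - by apply: curve_le; rewrite ge_min lexx.
  - by apply: curve_le; rewrite ge_min lexx orbT.
exists K; split; rewrite ?gt_max ?lt_min ?st ?tu//.
case=> [[b [x y]]|t2] /=.
  move=> [/KP[Nx N'x h1 [h2 h3 h4]] /andP[h5 h6]].
  have H1 : c s x < y by exact: le_lt_trans h5.
  have H2 : c s' x < y by exact: le_lt_trans h5.
  have H3 : y < c u x by exact: lt_le_trans h6 _.
  have H4 : y < c u' x by exact: lt_le_trans h6 _.
  by rewrite H1 H2 H3 H4.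
by rewrite gt_max lt_min => /andP[/andP[-> ->] /andP[-> ->]].
Unshelve. all: by end_near. Qed.

Lemma ray_surface_openT : ray_surface_open setT.
Proof.
split=> [b|[t ot] _]; first exact: openT.
by have [u tu] := curve_above c t; exists o, u, 0; split.
Qed.

Lemma ray_surface_openI : setI_closed ray_surface_open.
Proof.
move=> A B [Ab At] [Bb Bt].
split=> [b|t [/At[s [u [N [st tu sA]]]] /Bt[s' [u' [N' [st' tu' sB]]]]]].
  exact: (openI (Ab b) (Bb b)).
have [||s2 [u2 [N2 [s2t tu2 sub]]]] := @stripI (val t) s u N s' u' N'.
- by rewrite st.
- by rewrite st'.
exists s2, u2, N2; split=> // q /sub[/sA Aq /sB Bq]; by split.
Qed.

Lemma ray_surface_open_bigU (I : Type) (f : I -> set M) :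
  (forall i, ray_surface_open (f i)) -> ray_surface_open (\bigcup_i f i).
Proof.
move=> fo; split=> [b|t [i _ fit]].
  have -> : [set z : R * R | (\bigcup_i f i) (inl (b, z))] =
      \bigcup_i [set z : R * R | f i (inl (b, z))] by [].
  by apply: bigcup_open => i _; exact: (fo i).1.
have [s [u [N [st tu sf]]]] := (fo i).2 _ fit.
by exists s, u, N; split=> // q /sf fq; exists i.
Qed.

HB.instance Definition _ :=
  isOpenTopological.Build M ray_surface_openT ray_surface_openI ray_surface_open_bigU.

Lemma strip_open s u N : open (strip s u N).
Proof.
suff : ray_surface_open (strip s u N) by [].
split=> [b|t /andP[st tu]]; last by exists s, u, N; split.
pose f (z : R * R) := z.2 - c s z.1; pose g (z : R * R) := c u z.1 - z.2.
have cc v : continuous (fun z : R * R => c v z.1).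
  move=> z; apply: (@continuous_comp (R * R)%type R R fst (c v) z); first exact: cvg_fst.
  exact: curve_cont.
have cf : continuous f.
  by move=> z; apply: cvgB; [exact: cvg_snd|exact: cc].
have cg : continuous g.
  by move=> z; apply: cvgB; [exact: cc|exact: cvg_snd].
have -> : [set z : R * R | strip s u N (inl (b, z))] =
    (fst @^-1` [set x | N < x]) `&` (f @^-1` [set x | 0 < x]) `&`
    (g @^-1` [set x | 0 < x]).
  apply/seteqP; split=> [[x y]|[x y]]; rewrite /preimage/= /f/g/= !subr_gt0.
    by move=> [? /andP[]].
  by move=> [[? ?] ?]; split=> //; apply/andP.
apply: openI; first apply: openI.
- by apply: open_comp; [move=> z _; exact: cvg_fst|exact: open_gt].
- by apply: open_comp; [move=> z _; exact: cf|exact: open_gt].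
- by apply: open_comp; [move=> z _; exact: cg|exact: open_gt].
Qed.

Lemma nbhs_plane b (z : R * R) (A : set M) :
  nbhs (inl (b, z) : M) A <-> nbhs z [set z' | A (inl (b, z'))].
Proof.
split.
  rewrite nbhsE => -[B [[Bb _] Bz] BA]; rewrite nbhsE.
  by exists [set z' | B (inl (b, z'))]; [split=> //; exact: Bb|move=> z' /BA].
rewrite nbhsE => -[I [oI Iz] IA]; rewrite nbhsE.
exists [set q : M | match q with inl (b', z') => b' = b /\ I z' | inr _ => False end].
  split=> //; split=> // b'.
  have [->|bb'] := eqVneq b' b.
    by rewrite (_ : [set _ | _] = I)//; apply/seteqP; split=> // z' [].
  rewrite (_ : [set _ | _] = set0); first exact: open0.
  by apply/seteqP; split=> // z' [/eqP]; rewrite (negbTE bb').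
by move=> [[b' z']|//] [-> /IA].
Qed.

Lemma nbhs_ray t (A : set M) : nbhs (inr t : M) A <->
  exists s u N, [/\ (s < val t)%O, (val t < u)%O & strip s u N `<=` A].
Proof.
split.
  rewrite nbhsE => -[B [[_ Br] /Br[s [u [N [st tu sB]]]]] BA].
  by exists s, u, N; split=> // q /sB/BA.
move=> [s [u [N [st tu sA]]]].
apply: (@filterS _ (nbhs (inr t : M)) _ (strip s u N)) => //.
apply: open_nbhs_nbhs; split; [exact: strip_open|].
by rewrite /= st.
Qed.

Lemma nbhs_ray_curve t b (A : set M) : nbhs (inr t : M) A ->
  \forall x \near +oo, A (plane_pt b x (c (val t) x)).
Proof.
move=> /nbhs_ray[s [u [N [st tu sA]]]]; near=> x; apply: sA; split.
  by near: x; exact/nbhs_pinfty_gt/num_real.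
by apply/andP; split; near: x; exact: curve_lt.
Unshelve. all: by end_near. Qed.

Definition transverse (q : M) : R :=
  match q with inl (b, (x, _)) => (-1) ^+ b * expR (- x) | inr _ => 0 end.
Local Notation w := transverse.

Lemma transverse_continuous : continuous w.
Proof.
move=> [[b z]|t] A.
  have wE z' : w (inl (b, z')) = (-1) ^+ b * expR (- z'.1) by case: z'.
  move=> nA; apply/nbhs_plane.
  have H : (fun z : R * R => (-1) ^+ b * expR (- z.1)) @ z --> (-1) ^+ b * expR (- z.1).
    apply: cvgM; first exact: cvg_cst.
    apply: (@cvg_comp _ _ _ (fun z : R * R => - z.1) expR _ (nbhs (- z.1))).
      by apply: cvgN; exact: cvg_fst.
    exact: continuous_expR.
  rewrite -wE in H; have {}H := H _ nA.
  by apply: (@filterS _ (nbhs z) _ _ _ _ H) => z'; rewrite /preimage/= -wE.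
move=> /nbhs_ballP[e /= e0 eA]; apply/nbhs_ray.
have [u tu] := curve_above c (val t).
exists o, u, (- ln e); split=> //; first exact: valP.
move=> [[b [x y]]|t'] /=; last by move=> _; apply: eA; exact: ballxx.
move=> [ex _]; apply: eA; rewrite /ball/= sub0r normrN normrM normr_sign mul1r.
rewrite ger0_norm ?expR_ge0// -[ltRHS]lnK ?posrE// ltr_expR; lra.
Qed.

Lemma transverse_plane b x y : w (plane_pt b x y) = (-1) ^+ b * expR (- x).
Proof. by []. Qed.

Lemma transverse_neq0 b x y : w (plane_pt b x y) != 0.
Proof. by rewrite mulf_neq0// ?signr_eq0// gt_eqF// expR_gt0. Qed.

Lemma transverse_inj b x y b' x' y' :
  w (plane_pt b x y) = w (plane_pt b' x' y') -> b = b' /\ x = x'.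
Proof.
rewrite !transverse_plane => E.
have bb' : b = b'.
  have := congr1 (fun r => r < 0) E; rewrite !pmulr_llt0 ?expR_gt0//.
  by case: b b' {E} => [] []; rewrite ?expr0 ?expr1 ?ltrN10 ?ltr10.
split=> //; move: E; rewrite bb' => /mulfI; rewrite signr_eq0 => /(_ isT).
by move=> /expR_inj/oppr_inj.
Qed.

(** The abscissa of the vertical line at level [a]. *)
Definition depth (a : R) : R := - ln `|a|.

Lemma transverse_depth (a y : R) : a != 0 ->
  w (plane_pt (a < 0) (depth a) y) = a.
Proof.
move=> a0; rewrite transverse_plane /depth opprK lnK ?posrE ?normr_gt0//.
by rewrite -numEsign.
Qed.

Lemma level_plane (a : R) q : a != 0 -> w q = a ->
  exists y, q = plane_pt (a < 0) (depth a) y.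
Proof.
move=> a0; case: q => [[b [x y]]|t]; last first.
  by move=> /= E; rewrite -E eqxx in a0.
rewrite -(transverse_depth y a0) => /transverse_inj[-> ->].
by rewrite transverse_depth//; exists y.
Qed.

End Surf.

(** * Rulers along the leaves *)

Lemma ivt_between (R : realType) (f : R -> R) a b v : a < b -> continuous f ->
  f a < v < f b -> exists2 y, a < y < b & f y = v.
Proof.
move=> ab fc /andP[av vb].
have [||y yab fy] := @IVT R f a b v (ltW ab).
- exact: continuous_subspaceT.
- by rewrite ge_min le_max (ltW av) (ltW vb) orbT.
exists y => //; move: yab; rewrite in_itv/= => /andP[ay yb].
rewrite !lt_neqAle ay yb !andbT; apply/andP; split; apply/eqP => E.
  by move: av; rewrite E fy ltxx.
by move: vb; rewrite -E fy ltxx.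
Qed.

Section Charts.
Context (R : realType) d (T : orderTopologicalType d) (o : T)
  (c : curve_family R T).
Local Notation M := (ray_surface o c).
Local Notation w := (@transverse R d T o c).
Local Notation plane_pt := (@plane_pt R d T o c).

Hypothesis between : forall s t : T, (s < t)%O -> exists2 m, (s < m)%O & (m < t)%O.
Hypothesis ray_connected : connected [set t : T | (o < t)%O].

Definition below (u : T) : set M := fun q =>
  match q with inl _ => True | inr t => (val t < u)%O end.

(** A ruler weakly increases along the whole ray, but strictly only below [u]:
    no continuous real function is strictly increasing on a long ray. *)
Record ruler (u : T) (h : M -> R) := Ruler {
  ruler_cont : continuous h;
  ruler_plane : forall b x y y', y < y' -> h (plane_pt b x y) < h (plane_pt b x y');
  ruler_ray_le : forall t t', (val t <= val t')%O -> h (inr t) <= h (inr t');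
  ruler_ray_lt : forall t t', (val t < val t')%O -> (val t < u)%O ->
    h (inr t) < h (inr t') }.

Definition ray_in (t : T) : M :=
  match boolP (o < t)%O with
  | AltTrue ot => inr (exist _ t ot)
  | AltFalse _ => plane_pt true 0 0
  end.

Lemma ray_inE t (ot : (o < t)%O) : ray_in t = inr (exist _ t ot).
Proof.
rewrite /ray_in; case: {-}_ / boolP => [ot'|]; last by rewrite ot.
by congr inr; apply: val_inj.
Qed.

Lemma ray_in_val (t : {t : T | (o < t)%O}) : ray_in (val t) = inr t.
Proof. by case: t => t ot; rewrite ray_inE. Qed.

Lemma ray_in_continuous : {within [set t : T | (o < t)%O], continuous ray_in}.
Proof.
apply/subspace_continuousP => t /= ot A nA.
have : nbhs (ray_in t) A := nA.
rewrite (ray_inE ot) => /nbhs_ray[s [u [N [/= st tu sA]]]].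
suff : \forall t' \near t, (o < t')%O -> A (ray_in t') by [].
have : nbhs t [set` `]s, u[%O].
  by apply: open_nbhs_nbhs; split; [exact: itv_open|rewrite /= in_itv/= st].
apply: filterS => t' /=; rewrite in_itv/= => stu ot'.
by rewrite ray_inE; exact: sA.
Qed.

Lemma level_ray : w @^-1` [set 0] = ray_in @` [set t : T | (o < t)%O].
Proof.
apply/seteqP; split=> [[[b [x y]]|t] /= E|_ [t ot <-]].
- by case/negP: (@transverse_neq0 _ _ _ o c b x y); apply/eqP.
- by exists (val t); [exact: valP|exact: ray_in_val].
- by rewrite /preimage/= ray_inE.
Qed.

Lemma plane_continuous b x : continuous (plane_pt b x).
Proof.
move=> y A /nbhs_plane[[/= A1 A2] [n1 n2] sA].
apply: filterS n2 => y' Ay'; apply: (sA (x, y')).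
by split=> //=; exact: nbhs_singleton n1.
Qed.

Lemma ray_surface_level_connected a : connected (w @^-1` [set a]).
Proof.
have [->|a0] := eqVneq a 0.
  rewrite level_ray; apply: connected_continuous_connected => //.
  exact: ray_in_continuous.
have -> : w @^-1` [set a] = plane_pt (a < 0) (depth a) @` setT.
  apply/seteqP; split=> [q|_ [y _ <-]]; last exact: transverse_depth.
  by move=> /(level_plane a0)[y ->]; exists y.
apply: connected_continuous_connected.
  by apply/connected_intervalP.
by apply: continuous_subspaceT; exact: plane_continuous.
Qed.

Section Ruler.
Context (u : T) (h : M -> R).
Hypothesis hr : ruler u h.

Let hc : continuous h.
Proof. exact: ruler_cont hr. Qed.

Lemma ruler_injective p q : below u p -> below u q -> w p = w q -> h p = h q ->
  p = q.
Proof.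
case: p q => [[b [x y]]|t] [[b' [x' y']]|t'].
- move=> _ _ /transverse_inj[<- <-] E; congr (inl (_, (_, _))).
  have [yy'|y'y|//] := ltgtP y y'.
    by have := ruler_plane hr b x yy'; rewrite E ltxx.
  by have := ruler_plane hr b x y'y; rewrite E ltxx.
- by move=> _ _ /eqP E; case/negP: (@transverse_neq0 _ _ _ o c b x y).
- by move=> _ _ /esym/eqP E; case/negP: (@transverse_neq0 _ _ _ o c b' x' y').
- move=> /= tu t'u _ E; congr inr; apply: val_inj.
  have [tt'|t't|//] := ltgtP (val t) (val t').
    by have := ruler_ray_lt hr tt' tu; rewrite E ltxx.
  by have := ruler_ray_lt hr t't t'u; rewrite E ltxx.
Qed.

Lemma ruler_plane_cont b x : continuous (fun y => h (plane_pt b x y)).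
Proof.
move=> y; apply: (@cvg_comp _ _ _ (plane_pt b x) h _ (nbhs (plane_pt b x y))).
  exact: plane_continuous.
exact: hc.
Qed.

Lemma ray_ivt t1 t2 v : h (inr t1) < v < h (inr t2) ->
  exists t, [/\ h (inr t) = v, (val t1 < val t)%O & (val t < val t2)%O].
Proof.
move=> /andP[hv vh].
have : connected (h @` (ray_in @` [set t : T | (o < t)%O])).
  apply: connected_continuous_connected.
    by rewrite -level_ray; exact: ray_surface_level_connected.
  by apply: continuous_subspaceT; exact: hc.
move=> /connected_intervalP/(_ (h (inr t1)) (h (inr t2))).
move=> /(_ _ _ v)[].
- by exists (inr t1) => //; exists (val t1); [exact: valP|exact: ray_in_val].
- by exists (inr t2) => //; exists (val t2); [exact: valP|exact: ray_in_val].
- by rewrite !ltW.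
move=> _ [t ot <-]; rewrite ray_inE; set t' := exist _ _ _ => ht'.
exists t'; split=> //.
  rewrite ltNge; apply/negP => /(ruler_ray_le hr).
  by rewrite ht' leNgt hv.
rewrite ltNge; apply/negP => /(ruler_ray_le hr).
by rewrite ht' leNgt vh.
Qed.

(** Choose points [q1] and [q2] just before and after [p] on its leaf, with the
    part of the leaf between them in [O].  By continuity [h] stays below [h p]
    near [q1] and above it near [q2]; on each nearby leaf the intermediate value
    theorem then yields, between these two places, a point where [h] has any
    prescribed value close to [h p]. *)
Lemma ruler_open p (O : set M) : below u p -> nbhs p O ->
  nbhs (h p, w p) ((fun q => (h q, w q)) @` O).
Proof.
have hlt (q : M) r : (\forall q' \near q, h q' < (h q + r) / 2) \/ r <= h q.
  have [qr|] := ltP (h q) r; [left|by right].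
  have qm : h q < (h q + r) / 2 by lra.
  exact: (cvgr_lt _ (@hc q) _ qm).
have hgt (q : M) r : (\forall q' \near q, (h q + r) / 2 < h q') \/ h q <= r.
  have [qr|] := ltP r (h q); [left|by right].
  have qm : (h q + r) / 2 < h q by lra.
  exact: (cvgr_gt _ (@hc q) _ qm).
case: p => [[b [x0 y0]] _ /nbhs_plane|[t ot] tu].
- move=> [[/= A B] [nA nB] AB].
  have [e /= e0 eB] : exists2 e, 0 < e & forall y, `|y0 - y| < e -> B y.
    by have /nbhs_ballP[e e0 eB] := nB; exists e.
  pose y1 := y0 - e / 2; pose y2 := y0 + e / 2.
  have y01 : y1 < y0 by rewrite /y1; lra.
  have y02 : y0 < y2 by rewrite /y2; lra.
  set p : M := inl _.
  have n1 : \forall x \near x0, h (plane_pt b x y1) < (h (plane_pt b x0 y1) + h p) / 2.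
    have [|] := hlt (plane_pt b x0 y1) (h p); last first.
      by rewrite leNgt (ruler_plane hr).
    move=> /nbhs_plane [[/= A' B'] [nA' nB'] AB'].
    apply: filterS nA' => x Ax; apply: (AB' (x, y1)).
    by split=> //=; exact: nbhs_singleton.
  have n2 : \forall x \near x0, (h (plane_pt b x0 y2) + h p) / 2 < h (plane_pt b x y2).
    have [|] := hgt (plane_pt b x0 y2) (h p); last first.
      by rewrite leNgt (ruler_plane hr).
    move=> /nbhs_plane [[/= A' B'] [nA' nB'] AB'].
    apply: filterS nA' => x Ax; apply: (AB' (x, y2)).
    by split=> //=; exact: nbhs_singleton.
  have wp0 : w p != 0 := @transverse_neq0 _ _ _ o c b x0 y0.
  have [wpb dx0] : (w p < 0) = b /\ depth (w p) = x0.
    by have [<- <-] := @transverse_inj _ _ _ o c _ _ 0 _ _ y0 (transverse_depth o c 0 wp0).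
  have nz : \forall z \near h p,
      (h (plane_pt b x0 y1) + h p) / 2 < z < (h (plane_pt b x0 y2) + h p) / 2.
    have := ruler_plane hr b x0 y01; have := ruler_plane hr b x0 y02.
    rewrite -[plane_pt b x0 y0]/p => h1 h2.
    near=> z; apply/andP; split; near: z.
      apply: (cvgr_gt (h p)); [exact: cvg_id|lra].
    apply: (cvgr_lt (h p)); [exact: cvg_id|lra].
  have dc : @depth R @ (w p) --> x0.
    rewrite -dx0; apply: cvgN.
    have : {for w p, continuous (@ln R \o (fun a : R => `|a|))}.
      apply: continuous_comp; first exact: norm_continuous.
      by apply: continuous_ln; rewrite normr_gt0.
    exact.
  have na : \forall a \near w p, [/\ a != 0, (a < 0) = b, A (depth a) &
      h (plane_pt b (depth a) y1) < (h (plane_pt b x0 y1) + h p) / 2 /\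
      (h (plane_pt b x0 y2) + h p) / 2 < h (plane_pt b (depth a) y2)].
    have ns : \forall a \near w p, a != 0 /\ (a < 0) = b.
      rewrite -wpb; have [wn|wp|E] := ltgtP (w p) 0; last by rewrite E eqxx in wp0.
        near=> a; suff : a < 0 by move=> a0; split; [rewrite lt_eqF|exact: a0].
        near: a; exact: (cvgr_lt _ cvg_id _ wn).
      near=> a; suff : 0 < a by move=> a0; split; [rewrite gt_eqF|rewrite ltNge ltW].
      near: a; exact: (cvgr_gt _ cvg_id _ wp).
    near=> a.
    have [a0 ab] : a != 0 /\ (a < 0) = b by near: a.
    split=> //; first by near: a; exact: (dc _ nA).
    split; near: a; [exact: (dc _ n1)|exact: (dc _ n2)].
  exists ([set z | (h (plane_pt b x0 y1) + h p) / 2 < z < (h (plane_pt b x0 y2) + h p) / 2],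
    [set a | [/\ a != 0, (a < 0) = b, A (depth a) &
      h (plane_pt b (depth a) y1) < (h (plane_pt b x0 y1) + h p) / 2 /\
      (h (plane_pt b x0 y2) + h p) / 2 < h (plane_pt b (depth a) y2)]]) => //.
  move=> [z a] /= [/andP[z1 z2] [a0 ab Aa [a1 a2]]].
  have [||y yy hy] := @ivt_between R _ y1 y2 z _ (@ruler_plane_cont b (depth a)).
  - by rewrite /y1 /y2; lra.
  - by rewrite (lt_trans a1 z1) (lt_trans z2 a2).
  exists (plane_pt b (depth a) y); last first.
    by rewrite hy -ab transverse_depth.
  apply: (AB (_, _)); split=> //=; apply: eB.
  by move: yy; rewrite /y1 /y2 ltr_norml => /andP[? ?]; apply/andP; split; lra.
move=> /nbhs_ray[s [v [N [/= st tv sO]]]].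
have [s' os' s't] : exists2 s', (Order.max o s < s')%O & (s' < t)%O.
  by apply: between; rewrite gt_max ot st.
have [v' tv' v'v] := between tv.
move: os'; rewrite gt_max => /andP[os' ss'].
have ov' : (o < v')%O by exact: lt_trans ot tv'.
pose q0 : M := inr (exist _ t ot).
pose q1 : M := inr (exist _ s' os').
pose q2 : M := inr (exist _ v' ov').
have h1 : h q1 < h q0 by apply: (ruler_ray_lt hr) => //=; exact: lt_trans tu.
have h2 : h q0 < h q2 by exact: (ruler_ray_lt hr).
have n1 : \forall q \near q1, h q < (h q1 + h q0) / 2.
  by have [//|] := hlt q1 (h q0); rewrite leNgt h1.
have n2 : \forall q \near q2, (h q2 + h q0) / 2 < h q.
  by have [//|] := hgt q2 (h q0); rewrite leNgt h2.
have [X XP] : exists X, forall x, X < x ->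
    [/\ N < x, c s x < c s' x, c v' x < c v x, c s' x < c v' x &
      forall b, h (plane_pt b x (c s' x)) < (h q1 + h q0) / 2 /\
        (h q2 + h q0) / 2 < h (plane_pt b x (c v' x))].
  have n1b b := nbhs_ray_curve b n1; have n2b b := nbhs_ray_curve b n2.
  apply: pinfty_from; near=> x; split.
  - by near: x; exact/nbhs_pinfty_gt/num_real.
  - by near: x; exact: curve_lt.
  - by near: x; exact: curve_lt.
  - by near: x; apply: curve_lt; exact: lt_trans tv'.
  - by case; split; near: x; [exact: n1b|exact: n2b|exact: n1b|exact: n2b].
exists ([set z | (h q1 + h q0) / 2 < z < (h q2 + h q0) / 2], ball (0 : R) (expR (- X))).
  split; last by apply: nbhsx_ballx; exact: expR_gt0.
  rewrite /= -/q0; near=> z; apply/andP; split; near: z.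
    by apply: (cvgr_gt (h q0)); [exact: cvg_id|lra].
  by apply: (cvgr_lt (h q0)); [exact: cvg_id|lra].
move=> [z a] /= [/andP[z1 z2]]; rewrite /ball/= sub0r normrN => aX.
have [->|a0] := eqVneq a 0.
  have [|t' [ht' st' t'v]] := @ray_ivt (exist _ s' os') (exist _ v' ov') z.
    by rewrite -/q1 -/q2; apply/andP; split; lra.
  exists (inr t'); last by rewrite ht'.
  by apply: sO; rewrite /= (lt_trans ss' st')/= (lt_trans t'v v'v).
have Xa : X < depth a.
  by rewrite /depth ltrNr -ltr_expR lnK// posrE normr_gt0.
have [Na cs cv csv /(_ (a < 0))[ha1 ha2]] := XP _ Xa.
have [|y /andP[y1 y2] hy] := @ivt_between R _ _ _ z csv (@ruler_plane_cont (a < 0) (depth a)).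
  by rewrite (lt_trans ha1 z1) (lt_trans z2 ha2).
exists (plane_pt (a < 0) (depth a) y); last by rewrite hy transverse_depth.
apply: sO; split=> //; apply/andP; split; first exact: lt_trans y1.
exact: lt_trans cv.
Unshelve. all: by end_near. Qed.

End Ruler.
End Charts.

(** * Topology and leaves of the surface *)

Section Surface.
Context (R : realType) d (T : orderTopologicalType d) (o : T)
  (c : curve_family R T).
Local Notation M := (ray_surface o c).
Local Notation w := (@transverse R d T o c).
Local Notation plane_pt := (@plane_pt R d T o c).

Hypothesis between : forall s t : T, (s < t)%O -> exists2 m, (s < m)%O & (m < t)%O.
Hypothesis ray_connected : connected [set t : T | (o < t)%O].
Hypothesis rulers : forall u, exists h : M -> R, ruler u h.

Lemma below_open u : open (below u : set M).
Proof.
rewrite openE => -[[b z]|t] /= tu; first by apply/nbhs_plane; exact: filterT.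
apply/nbhs_ray; exists o, u, 0; split=> //; first exact: valP.
by move=> [[b [x y]]//|t'] /= /andP[].
Qed.

Lemma below2 (p q : M) : exists u, below u p /\ below u q.
Proof.
case: p q => [z|t] [z'|t'].
- by exists o.
- by have [v tv] := curve_above c (val t'); exists v.
- by have [v tv] := curve_above c (val t); exists v.
- have [v tv] := curve_above c (Order.max (val t) (val t')); exists v.
  by move: tv; rewrite gt_max => /andP[].
Qed.

Lemma below_ex (p : M) : exists u, below u p.
Proof. by have [u []] := below2 p p; exists u. Qed.

(** [Y] stands for the two models of the plane that charts are valued in,
    [R * 'rV_1] for box charts and ['rV_2] for Euclidean ones. *)
Section RulerChart.
Context (u : T) (h : M -> R) (hr : ruler u h).
Context (Y : topologicalType) (j : R * R -> Y) (k : Y -> R * R).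
Hypotheses (jc : continuous j) (kc : continuous k).
Hypotheses (jK : cancel j k) (kK : cancel k j).
Let f q := j (h q, w q).

Lemma ruler_chart_continuous : continuous f.
Proof.
move=> q; apply: (@continuous_comp M (R * R)%type Y (fun q => (h q, w q)) j).
  apply: pair_continuous; first exact: (ruler_cont hr).
  exact: transverse_continuous.
exact: jc.
Qed.

Lemma ruler_chart_open p (A : set M) : below u p -> nbhs p A ->
  nbhs (f p) (f @` A).
Proof.
move=> up pA; have := nbhs_push kc jK kK (ruler_open between ray_connected hr up pA).
by rewrite image_comp.
Qed.

Lemma ruler_chart (B : set Y) : (below u : set M) !=set0 -> B `<=` f @` below u ->
  homeomorphism_on (below u `&` f @^-1` B) B f.
Proof.
move=> u0; apply: open_injection_homeomorphism => //.
- exact: ruler_chart_continuous.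
- move=> p q; rewrite !inE => up uq /(can_inj jK)[hpq wpq].
  exact: (ruler_injective hr).
- exact: below_open.
- by move=> p A up pA; exact: ruler_chart_open.
Qed.

Lemma ruler_chart_domain (B : set Y) : open B -> open (below u `&` f @^-1` B).
Proof.
move=> oB; apply: openI; first exact: below_open.
by apply: open_comp => // q _; exact: ruler_chart_continuous.
Qed.

End RulerChart.

Lemma ray_surface_straight p : exists2 ch : chart R 2 M, straight_atlas w ch &
  ch.1 p /\ forall q, ch.1 q -> (ch.2 q).2 = const_mx (w q).
Proof.
have [u up] := below_ex p; have [h hr] := rulers u.
have := ruler_open between ray_connected hr up (open_nbhs_nbhs (conj (below_open u) up)).
move=> [[/= A1 A2] [/nbhs_ballP[e1 /= e10 eA1] /nbhs_ballP[e2 /= e20 eA2]] sA].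
pose I := `](h p - e1), (h p + e1)[.
pose J := `](w p - e2), (w p + e2)[.
pose B : set (R * 'rV[R]_1) := [set` I] `*` [set y : 'rV[R]_1 | forall i, y 0 i \in J].
pose f q := box_of_pair (h q, w q).
have fB : B `<=` f @` below u.
  move=> [a v] /= [/= aI vJ].
  have : (A1 `*` A2) (a, v 0 0).
    split=> /=.
      apply: eA1; rewrite /ball/= ltr_norml; move: aI; rewrite in_itv/=.
      by move=> /andP[? ?]; apply/andP; split; lra.
    apply: eA2; rewrite /ball/= ltr_norml; move: (vJ 0); rewrite in_itv/=.
    by move=> /andP[? ?]; apply/andP; split; lra.
  move=> /sA[q uq [hq wq]]; exists q => //.
  by rewrite /f hq wq -[(a, v 0 0)]/(pair_of_box (a, v)) pair_of_boxK.
have Bp : B (f p).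
  split=> /=; first by rewrite in_itv/=; apply/andP; split; lra.
  by move=> i; rewrite mxE in_itv/=; apply/andP; split; lra.
have oB : open B.
  have -> : B = pair_of_box (R := R) @^-1` ((fst @^-1` [set` I]) `&` (snd @^-1` [set` J])).
    apply/seteqP; split=> [[a v] [/= aI vJ]|[a v] [/= aI vJ]]; split=> //=.
    by move=> i; rewrite ord1.
  apply: open_comp; first by move=> v _; exact: pair_of_box_continuous.
  apply: openI; (apply: open_comp; [|exact: itv_open]) => z _.
    exact: cvg_fst.
  exact: cvg_snd.
exists (below u `&` f @^-1` B, f); last by split.
split; last first.
  move=> q [uq Bq]; exists (fun a => const_mx a), (fun v => v 0 0).
  by near=> r; rewrite mxE.
split; first exact: (ruler_chart_domain hr (@box_of_pair_continuous R)).
exists B; last first.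
  apply: (ruler_chart hr (@box_of_pair_continuous R) (@pair_of_box_continuous R)
    (@box_of_pairK R) (@pair_of_boxK R)) => //.
  by exists p.
exists I, (fun=> J); split=> //.
by exists (f p).
Unshelve. all: by end_near. Qed.

Lemma ray_surface_locally_euclidean : locally_euclidean R 2 M.
Proof.
move=> p; have [u up] := below_ex p; have [h hr] := rulers u.
pose f q := row_of_pair (h q, w q).
have oV : open (f @` below u).
  rewrite openE => _ [q uq <-].
  apply: (ruler_chart_open hr (@pair_of_row_continuous R)
    (@row_of_pairK R) (@pair_of_rowK R)) => //.
  exact: open_nbhs_nbhs (conj (below_open u) uq).
exists (below u `&` f @^-1` (f @` below u)), (f @` below u); split=> //.
- exact: (ruler_chart_domain hr (@row_of_pair_continuous R)).
- by split=> //; exists p.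
exists f; apply: (ruler_chart hr (@row_of_pair_continuous R)
  (@pair_of_row_continuous R) (@row_of_pairK R) (@pair_of_rowK R)) => //.
by exists p.
Qed.

(** [transverse] and the rulers separate points. *)
Lemma ray_surface_hausdorff : hausdorff_space M.
Proof.
have sep (f : M -> R) p q : continuous f -> cluster (nbhs p) q -> f p = f q.
  move=> fc pq; apply: (@Rhausdorff R) => A B nA nB.
  by have [r [Ar Br]] := pq _ _ (fc p _ nA) (fc q _ nB); exists (f r).
move=> p q pq; have [u [up uq]] := below2 p q; have [h hr] := rulers u.
apply: (ruler_injective hr) => //; apply: sep => //.
- exact: transverse_continuous.
- exact: (ruler_cont hr).
Qed.

(** A clopen set is a union of fibres of [transverse], so its image and the image
    of its complement are disjoint open sets that cover [R]. *)
Lemma ray_surface_connected : connected [set: M].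
Proof.
have [t0 ot0] := curve_above c o.
have wopen (A : set M) : open A -> open (w @` A).
  move=> oA; rewrite openE => _ [p Ap <-].
  have [u up] := below_ex p; have [h hr] := rulers u.
  have [[/= B C] [nB nC] BC] :=
    ruler_open between ray_connected hr up (open_nbhs_nbhs (conj oA Ap)).
  apply: filterS nC => a Ca.
  have [|q Aq [_ qa]] := BC (h p, a); first by split=> //; exact: nbhs_singleton.
  by exists q.
have wsurj a : exists q, w q = a.
  have [->|a0] := eqVneq a 0; first by exists (inr (exist _ t0 ot0)).
  by exists (plane_pt (a < 0) (depth a) 0); exact: transverse_depth.
move=> B [b Bb] [C oC]; rewrite setTI => BC [D cD]; rewrite setTI => BD.
have fib p q : B p -> w p = w q -> B q.
  move=> Bp pq.
  have := @ray_surface_level_connected R d T o c ray_connected (w p) (w @^-1` [set w p] `&` B).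
  move=> H; have : (w @^-1` [set w p] `&` B) q; last by case.
  rewrite H//.
  - by exists p.
  - by exists B => //; rewrite BC.
  - by exists B => //; rewrite BD.
have oB : open B by rewrite BC.
have oB' : open (~` B) by rewrite openC BD.
have RT : w @` B = setT.
  have : connected [set: R] by apply/connected_intervalP.
  apply.
  - by exists (w b), b.
  - by exists (w @` B); [exact: wopen|rewrite setTI].
  - exists (w @` B); last by rewrite setTI.
    rewrite -openC (_ : ~` _ = w @` (~` B)); first exact: wopen.
    apply/seteqP; split=> [a na|_ [q nBq <-] [p Bp pq]].
      by have [q qa] := wsurj a; exists q => // Bq; apply: na; exists q.
    exact/nBq/(fib p).
apply/seteqP; split=> // q _.
by have [p Bp pq] : (w @` B) (w q); [rewrite RT|exact: (fib p)].
Qed.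

Lemma ray_surface_surface : surface R M.
Proof.
split; first exact: ray_surface_connected.
  exact: ray_surface_hausdorff.
exact: ray_surface_locally_euclidean.
Qed.

Lemma open_meets_plane (A : set M) : open A -> A !=set0 ->
  exists b (z : R * R), A (inl (b, z)).
Proof.
move=> oA [[[b z]|t] Ap]; first by exists b, z.
have [s [u [N [st tu sA]]]] := (iffLR (nbhs_ray _ _)) (open_nbhs_nbhs (conj oA Ap)).
have [x [Nx sux]] : exists x, N < x /\ c s x < c u x.
  have [X XP] := pinfty_from (curve_lt c (lt_trans st tu)).
  exists (Num.max N X + 1); split; last apply: XP.
    by rewrite ltr_pwDr// le_max lexx.
  by rewrite ltr_pwDr// le_max lexx orbT.
exists true, (x, (c s x + c u x) / 2); apply: sA => /=.
by split=> //; apply/andP; split; lra.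
Qed.

Lemma ray_surface_separable : separable M.
Proof.
exists ((fun k : bool * (rat * rat) => plane_pt k.1 (ratr k.2.1) (ratr k.2.2)) @` setT).
  by apply: sub_countable (countableP [set: bool * (rat * rat)]); exact: card_image_le.
move=> A A0 oA; have [b [[x y] Az]] := open_meets_plane oA A0.
have /nbhs_plane[[/= B C] [nB nC] BC] := open_nbhs_nbhs (conj oA Az).
have [qB [Bq [r _ Br]]] : B° `&` range (@ratr R) !=set0.
  apply: dense_rat; last exact: open_interior.
  by exists x.
have [qC [Cq [r' _ Cr]]] : C° `&` range (@ratr R) !=set0.
  apply: dense_rat; last exact: open_interior.
  by exists y.
exists (plane_pt b (ratr r) (ratr r')); split; last by exists (b, (r, r')).
by apply: (BC (_, _)); split=> /=; [rewrite Br|rewrite Cr]; exact: interior_subset.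
Qed.

Lemma level_ray_homeomorphic :
  homeomorphic (w @^-1` [set 0]) [set t : T | (o < t)%O].
Proof.
pose f (q : M) : T := match q with inl _ => o | inr t => val t end.
have fK t : (o < t)%O -> f (ray_in o c t) = t by move=> ot; rewrite ray_inE.
exists f, (ray_in o c); split.
- split=> [q|t ot]; rewrite level_ray; last by exists t.
  by move=> [t ot <-]; rewrite /= fK.
- split=> [q|t]; rewrite inE; last exact: fK.
  by rewrite level_ray => -[t ot <-]; rewrite fK.
- apply/subspace_continuousP => q; rewrite {1}level_ray => -[t ot <-] A.
  move=> nA; have {}nA : nbhs t A by rewrite -[t]fK//; exact: nA.
  have [s [u [st tu sA]]] := open_ray_nbhs (curve_above c) ot nA.
  suff : \forall q \near (ray_in o c t : M), w q = 0 -> A (f q) by [].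
  rewrite ray_inE.
  apply/nbhs_ray; exists s, u, 0; split=> // q' sq; rewrite -[w q' = 0]/((w @^-1` [set 0]) q').
  rewrite level_ray => -[t' ot' E]; move: sq; rewrite -E fK// ray_inE => /andP[].
  exact: sA.
- exact: ray_in_continuous.
Qed.

Lemma level_line_homeomorphic a : a != 0 ->
  homeomorphic (w @^-1` [set a]) [set: R].
Proof.
move=> a0; pose f (q : M) : R := match q with inl (_, (_, y)) => y | inr _ => 0 end.
exists f, (plane_pt (a < 0) (depth a)); split.
- by split=> // y _; exact: transverse_depth.
- by split=> // q; rewrite inE => /(level_plane a0)[y ->].
- apply/subspace_continuousP => q /(level_plane a0)[y ->] A nA.
  suff : \forall q \near plane_pt (a < 0) (depth a) y, w q = a -> A (f q) by [].
  apply/nbhs_plane; exists (setT, A); first by split=> //; exact: filterT.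
  by move=> [x' y'] [/= _ Ay'].
- by apply: continuous_subspaceT; exact: plane_continuous.
Qed.

End Surface.

(** * Rulers for a tower of curves *)

Section TowerSurface.
Context (R : realType) (tw : tower R).
Context d (T : orderTopologicalType d) (k : lex_coords R T) (o : T).
Local Notation block := (lex_block k).
Local Notation height := (lex_height k).
Local Notation point := (lex_point k).
Local Notation lexP := (lex_ltP k).

Definition tower_curve (t : T) (x : R) : R := tw (block t) x + height t.

Lemma tower_curve_cont t : continuous (tower_curve t).
Proof.
by move=> x; apply: cvgD; [exact: tower_cont|exact: cvg_cst].
Qed.

Lemma tower_curve_lt (s t : T) : (s < t)%O ->
  \forall x \near +oo, tower_curve s x < tower_curve t x.
Proof.
have s1 := height_lt1 k s; have t0 := height_ge0 k t.
case/lexP => [/(tower_lt tw)|[E st]].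
  by apply: filterS => x; rewrite /tower_curve; lra.
by near=> x; rewrite /tower_curve E; lra.
Unshelve. all: by end_near. Qed.

Definition tower_curves : curve_family R T :=
  CurveFamily tower_curve_cont (lex_above k) tower_curve_lt.

Local Notation c := tower_curves.
Local Notation M := (ray_surface o c).

(** The height above the start of the block [a], clamped to the block. *)
Definition ray_coord (a : omega1) (t : T) : R :=
  if (block t < a)%O then 0 else if (a < block t)%O then 1 else height t.

(** The two clauses fit together since the point of height [r] in the block [a]
    is the limit of the curve [y = tw a x + r]. *)
Definition block_coord (a : omega1) (q : M) : R :=
  match q with
  | inl (_, (x, y)) => clamp (y - tw a x)
  | inr t => ray_coord a (val t)
  end.

Lemma ray_coord_lt a t : (block t < a)%O -> ray_coord a t = 0.
Proof. by rewrite /ray_coord => ->. Qed.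

Lemma ray_coord_gt a t : (a < block t)%O -> ray_coord a t = 1.
Proof. by rewrite /ray_coord => at1; rewrite at1 ltNge (ltW at1). Qed.

Lemma ray_coord_eq a t : block t = a -> ray_coord a t = height t.
Proof. by rewrite /ray_coord => ->; rewrite ltxx. Qed.

Lemma block_coord01 a q : 0 <= block_coord a q <= 1.
Proof.
case: q => [[b [x y]]|t] /=; first exact: clamp01.
have [h|h|h] := ltgtP (block (val t)) a.
- by rewrite ray_coord_lt// lexx ler01.
- by rewrite ray_coord_gt// lexx ler01.
- by rewrite ray_coord_eq// height_ge0 (ltW (height_lt1 _ _)).
Qed.

Lemma ray_coord_le_lt a (t u : T) : (t < u)%O -> block u = a -> ray_coord a t <= height u.
Proof.
move=> /lexP[tu|[tu h]] ua.
  by rewrite ray_coord_lt ?height_ge0// -ua.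
by rewrite ray_coord_eq ?ltW// tu.
Qed.

Lemma ray_coord_ge_gt a (s t : T) : (s < t)%O -> block s = a -> height s <= ray_coord a t.
Proof.
move=> /lexP[st|[st h]] sa.
  by rewrite ray_coord_gt ?(ltW (height_lt1 _ _))// -sa.
by rewrite ray_coord_eq ?ltW// -st.
Qed.

Lemma ray_coord_mono a (s t : T) : (s < t)%O -> ray_coord a s <= ray_coord a t.
Proof.
move=> st.
have [/andP[s0 s1] /andP[t0 t1]] :
    0 <= ray_coord a s <= 1 /\ 0 <= ray_coord a t <= 1.
  suff H v : 0 <= ray_coord a v <= 1 by [].
  have [h|h|h] := ltgtP (block v) a.
  - by rewrite ray_coord_lt// lexx ler01.
  - by rewrite ray_coord_gt// lexx ler01.
  - by rewrite ray_coord_eq// height_ge0 (ltW (height_lt1 _ _)).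
have [h|h|h] := ltgtP (block s) a.
- by rewrite (ray_coord_lt h).
- rewrite (ray_coord_gt h) ray_coord_gt//; case/lexP: st => [|[<-]//].
  exact: lt_trans.
- by rewrite (ray_coord_eq h); exact: ray_coord_ge_gt.
Qed.

Lemma ray_coord_strict (s t : T) : (s < t)%O -> ray_coord (block s) s < ray_coord (block s) t.
Proof.
rewrite (ray_coord_eq erefl) => /lexP[st|[st h]].
  by rewrite ray_coord_gt ?height_lt1.
by rewrite ray_coord_eq.
Qed.

Lemma block_coord_upper a t (u : T) e : (val t < u)%O -> block u = a -> height u < e ->
  \forall q \near (inr t : M), block_coord a q < e.
Proof.
move=> tu ua ue; apply/nbhs_ray; exists o, u, 0; split=> //; first exact: valP.
have u0 := height_ge0 k u; have u1 := height_lt1 k u.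
move=> [[b [x y]]|t'] /=.
  move=> [_ /andP[_ yu]]; apply: le_lt_trans ue.
  rewrite -(@clampid _ (height u)); last by rewrite u0 ltW.
  apply: clamp_le.
  by move: yu; rewrite /tower_curve ua => /ltW; rewrite lerBlDl.
by move=> /andP[_ t'u]; apply: le_lt_trans ue; exact: ray_coord_le_lt.
Qed.

Lemma block_coord_lower a t (s : T) e : (s < val t)%O -> block s = a -> e < height s ->
  \forall q \near (inr t : M), e < block_coord a q.
Proof.
move=> st sa se.
have [u tu] := lex_above k (val t).
apply/nbhs_ray; exists s, u, 0; split=> //.
have s0 := height_ge0 k s; have s1 := height_lt1 k s.
move=> [[b [x y]]|t'] /=.
  move=> [_ /andP[sy _]]; apply: lt_le_trans se _.
  rewrite -(@clampid _ (height s)); last by rewrite s0 ltW.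
  apply: clamp_le.
  by move: sy; rewrite /tower_curve sa => /ltW; rewrite lerBrDl.
by move=> /andP[st' _]; apply: lt_le_trans se _; exact: ray_coord_ge_gt.
Qed.

Lemma plane_continuous_at (f : M -> R) b z :
  {for z, continuous (fun z => f (inl (b, z)))} -> {for (inl (b, z) : M), continuous f}.
Proof. by move=> fc A nA; apply/nbhs_plane; exact: (fc _ nA). Qed.

(** At a point [t] of the ray, a bound on [block_coord a] is obtained from a
    point [(a, r)] of the block on the relevant side of [t]; where there is no
    such point, the coordinate has there its extreme value [0] or [1]. *)
Lemma block_coord_continuous a : continuous (block_coord a).
Proof.
move=> [[b z]|t].
  apply: plane_continuous_at.
  have H : continuous (fun z : R * R => z.2 - tw a z.1).
    move=> z1; apply: cvgB; first exact: cvg_snd.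
    apply: (@continuous_comp (R * R)%type R R fst (tw a) z1); first exact: cvg_fst.
    exact: tower_cont.
  have K : continuous (clamp (R := R) \o (fun z : R * R => z.2 - tw a z.1)).
    by move=> z1; apply: continuous_comp; [exact: H|exact: clamp_continuous].
  have -> : (fun z => block_coord a (inl (b, z))) =
      clamp (R := R) \o (fun z : R * R => z.2 - tw a z.1).
    by apply/funext => -[].
  exact: K.
have t0 := height_ge0 k (val t); have t1 := height_lt1 k (val t).
have r0 : 0 <= (0 : R) < 1 by rewrite lexx ltr01.
have up e : block_coord a (inr t) < e -> \forall q \near (inr t : M), block_coord a q < e.
  have below_pt r : 0 <= r < 1 -> (val t < point a r)%O -> r < e ->
      \forall q \near (inr t : M), block_coord a q < e.
    move=> r01 tr re; apply: (block_coord_upper tr); first exact: lex_block_point.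
    by rewrite lex_height_point.
  move=> te; have [h|h|h] := ltgtP (block (val t)) a.
  - apply: (below_pt 0) => //; last by move: te; rewrite /= ray_coord_lt.
    by apply/lexP; left; rewrite lex_block_point.
  - near=> q; have /andP[_ ] := block_coord01 a q.
    by move: te; rewrite /= ray_coord_gt//; lra.
  - move: te; rewrite /= ray_coord_eq// => te.
    (* The midpoint of [height (val t)] and [Num.min 1 e]. *)
    have [r /andP[tr r1] re] : exists2 r, height (val t) < r < 1 & r < e.
      exists ((height (val t) + Num.min 1 e) / 2).
        by have : height (val t) < Num.min 1 e <= 1; [rewrite lt_min t1 te ge_min lexx|lra].
      by have : height (val t) < Num.min 1 e <= e; [rewrite lt_min t1 te ge_min lexx orbT|lra].
    have r01 : 0 <= r < 1 by lra.
    apply: (below_pt r) => //.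
    by apply/lexP; right; rewrite lex_block_point// lex_height_point.
have low e : e < block_coord a (inr t) -> \forall q \near (inr t : M), e < block_coord a q.
  have above_pt r : 0 <= r < 1 -> (point a r < val t)%O -> e < r ->
      \forall q \near (inr t : M), e < block_coord a q.
    move=> r01 tr re; apply: (block_coord_lower tr); first exact: lex_block_point.
    by rewrite lex_height_point.
  move=> te; have [e0|e0] := ltP e 0.
    by near=> q; have /andP[+ _] := block_coord01 a q; lra.
  have [h|h|h] := ltgtP (block (val t)) a.
  - by move: te; rewrite /= ray_coord_lt//; lra.
  - move: te; rewrite /= ray_coord_gt// => te.
    have r01 : 0 <= (e + 1) / 2 < 1 by lra.
    apply: (above_pt ((e + 1) / 2)) => //; last by lra.
    by apply/lexP; left; rewrite lex_block_point.
  - move: te; rewrite /= ray_coord_eq// => te.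
    have r01 : 0 <= (e + height (val t)) / 2 < 1 by lra.
    apply: (above_pt ((e + height (val t)) / 2)) => //; last by lra.
    apply/lexP; right; rewrite lex_block_point// lex_height_point//.
    by split=> //; lra.
apply/(@cvgrPdist_lt _ _ _ _ (nbhs_filter (inr t : M))) => e e0.
have U := up (block_coord a (inr t) + e) ltac:(lra).
have L := low (block_coord a (inr t) - e) ltac:(lra).
suff : \forall q \near (inr t : M), `|block_coord a (inr t) - block_coord a q| < e by [].
near=> q; rewrite ltr_norml.
have qU : block_coord a q < block_coord a (inr t) + e by near: q.
have qL : block_coord a (inr t) - e < block_coord a q by near: q.
by apply/andP; split; lra.
Unshelve. all: by end_near. Qed.

(** Takes values in [[0, 1]], is strictly increasing in [y], and tends to [0] as
    [x] tends to [+oo], uniformly in [y], so that it extends continuously by [0]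
    to the ray. *)
Definition tilt (q : M) : R :=
  match q with
  | inl (_, (x, y)) => expR (- (expR x + expR (- y)))
  | inr _ => 0
  end.

Lemma tilt01 q : 0 <= tilt q <= 1.
Proof.
case: q => [[b [x y]]|t] /=; last by rewrite lexx ler01.
by rewrite expR_ge0 -expR0 ler_expR oppr_le0 addr_ge0 ?expR_ge0.
Qed.

Lemma tilt_continuous : continuous tilt.
Proof.
move=> [[b z]|t].
  apply: plane_continuous_at.
  have cE (f : R * R -> R) : continuous f -> continuous (fun z => expR (f z)).
    move=> fc z1; apply: (@continuous_comp (R * R)%type R R f expR z1); first exact: fc.
    exact: continuous_expR.
  have K : continuous (fun z : R * R => expR (- (expR z.1 + expR (- z.2)))).
    apply: (cE _) => z1; apply: cvgN; apply: cvgD.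
      by apply: (cE _) => z2; exact: cvg_fst.
    by apply: (cE _) => z2; apply: cvgN; exact: cvg_snd.
  have -> : (fun z => tilt (inl (b, z))) =
      (fun z : R * R => expR (- (expR z.1 + expR (- z.2)))).
    by apply/funext => -[].
  exact: K.
apply/(@cvgrPdist_lt _ _ _ _ (nbhs_filter (inr t : M))) => e e0; apply/nbhs_ray.
have [u tu] := lex_above k (val t).
exists o, u, (- ln e); split=> //; first exact: valP.
move=> [[b [x y]]|t'] /=; last by rewrite subrr normr0.
move=> [ex _]; rewrite sub0r normrN ger0_norm ?expR_ge0//.
rewrite -[ltRHS]lnK ?posrE// ltr_expR.
have := expR_gt0 (- y); have := expR_ge1Dx x; lra.
Qed.

(** [tilt] makes the weighted sum strict on the vertical lines, and the
    coordinate of its own block makes it strict at each point below [u]. *)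
Lemma tower_ruler (u : T) : exists h : M -> R, ruler u h.
Proof.
have /pcard_injP[e einj] := omega1_countable (block u).
pose a n := xget (block u) [set b | (b < block u)%O /\ e b = n].
pose g n : M -> R := match n with
  | 0 => tilt | 1 => block_coord (block u) | n.+2 => block_coord (a n) end.
have gcoord b : (b <= block u)%O -> exists n, g n = block_coord b.
  rewrite le_eqVlt => /predU1P[->|bu]; first by exists 1%N.
  exists (e b).+2; rewrite /g; congr block_coord; rewrite /a.
  case: xgetP => [b' _ [b'u eb']|/(_ b)]; last by case.
  by apply: einj; rewrite ?inE.
have gE n : g n = tilt \/ exists b, g n = block_coord b.
  by case: n => [|[|n]]; [left|right; exists (block u)|right; exists (a n)].
have gc n : continuous (g n).
  by have [->|[b ->]] := gE n; [exact: tilt_continuous|exact: block_coord_continuous].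
have g01 n q : 0 <= g n q <= 1.
  by have [->|[b ->]] := gE n; [exact: tilt01|exact: block_coord01].
have [h [hc hle hlt]] := weighted_sum gc g01.
have g_ray t t' : (val t < val t')%O -> forall n, g n (inr t) <= g n (inr t').
  by move=> tt' n; have [->|[b ->]] := gE n; [exact: lexx|exact: ray_coord_mono].
exists h; split=> //.
- move=> b x y y' yy'.
  have tlt : tilt (plane_pt o c b x y) < tilt (plane_pt o c b x y').
    by rewrite /= ltr_expR ltrN2 ltrD2l ltr_expR ltrN2.
  apply: hlt; last by exists 0%N.
  move=> n; have [->|[a' ->]] := gE n; first exact: ltW.
  by apply: clamp_le; lra.
- move=> t t'; rewrite le_eqVlt => /predU1P[E|tt'].
    by rewrite (val_inj E).
  by apply: hle; exact: g_ray.
- move=> t t' tt' tu; apply: hlt; first exact: g_ray.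
  have [|n gn] := gcoord (block (val t)).
    by case/lexP: tu => [/ltW//|[-> _]].
  by exists n; rewrite gn; exact: ray_coord_strict.
Qed.

(** The exceptional leaf is an arbitrary upper ray of an order with lexicographic
    coordinates; the point [o] fixes where it begins. *)
Theorem tower_surface :
  exists (N : topologicalType) (F : foliation R 2 N),
    [/\ surface R N, separable N &
      exists L0 : set (leaf_space F),
        [/\ leaf L0,
            homeomorphic L0 [set t : T | (o < t)%O],
            forall L : set (leaf_space F),
              leaf L -> L <> L0 -> homeomorphic L [set: R] &
            forall U : set N, set_nbhs (L0 : set N) U ->
              exists L : set (leaf_space F),
                [/\ leaf L, ~ long_leaf L & (L : set N) `&` U !=set0]]].
Proof.
have between := lex_between k.
have ray_conn : connected [set t : T | (o < t)%O] by exact: lex_ray_connected k o.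
pose F := level_foliation (ray_surface_straight between ray_conn tower_ruler).
have lconn := @ray_surface_level_connected R d T o c ray_conn.
have leafE p : connected_component [set: leaf_space F] p =
    @transverse R d T o c @^-1` [set transverse (p : M)].
  by apply: level_componentE => a; exact: lconn.
exists M, F; split.
- exact: (ray_surface_surface between ray_conn tower_ruler).
- exact: ray_surface_separable.
have [t0 t00] := lex_above k o.
pose p0 : M := inr (exist _ t0 t00).
exists (@transverse R d T o c @^-1` [set 0]); split.
- by exists p0; rewrite leafE.
- by apply: level_homeomorphic; exact: level_ray_homeomorphic.
- move=> L [p ->]; rewrite leafE => L0; apply: level_homeomorphic.
  by apply: level_line_homeomorphic; apply/eqP => E; apply: L0; rewrite E.
move=> U UL0; have nU : nbhs p0 U by exact: UL0.
have [b [z Uz]] := open_meets_plane (open_interior U) (ex_intro _ p0 nU).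
exists (connected_component [set: leaf_space F] (inl (b, z) : M)); split.
- by exists (inl (b, z) : M).
- move=> [_]; apply; split; first by exists (inl (b, z) : M).
  have wz : transverse (inl (b, z) : M) != 0.
    by case: z {Uz} => x y; exact: transverse_neq0.
  right; rewrite leafE; apply: level_homeomorphic.
  exact: level_line_homeomorphic wz.
- exists (inl (b, z) : M); split; last exact: nbhs_singleton Uz.
  by rewrite leafE.
Qed.

End TowerSurface.

(** * The long ray *)

Section ClosedLongRay.
Context (R : realType).
Local Notation ray := (closed_long_ray R).

Definition ray_height (t : ray) : R := val t.2.
Definition ray_point (a : omega1) (r : R) : ray := (a, insubd (unit_co_0 R) r).

Lemma ray_height01 t : 0 <= ray_height t < 1.
Proof. exact: (valP t.2). Qed.

Lemma ray_height_point a r : 0 <= r < 1 -> ray_height (ray_point a r) = r.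
Proof. by move=> r01; rewrite /ray_height [LHS]val_insubd r01. Qed.

Lemma ray_ltP (s t : ray) :
  reflect ((s.1 < t.1)%O \/ s.1 = t.1 /\ ray_height s < ray_height t) (s < t)%O.
Proof.
apply: (iffP idP) => [st|H].
  have : @Order.lt _ (omega1 *l unit_co R)%type s t by [].
  rewrite Order.ProdLexiOrder.ltEprodlexi => /andP[].
  rewrite le_eqVlt => /predU1P[E|]; last by left.
  by rewrite E lexx /= => h; right.
suff : @Order.lt _ (omega1 *l unit_co R)%type s t by [].
rewrite Order.ProdLexiOrder.ltEprodlexi.
case: H => [h|[-> h]]; last by rewrite lexx.
by rewrite (ltW h) leNgt h.
Qed.

Definition ray_coords : lex_coords R ray :=
  LexCoords ray_height01 (fun a r _ => erefl) ray_height_point ray_ltP.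

Lemma long_rayE : long_ray R = [set t | ((omega1_0, unit_co_0 R) < t :> ray)%O].
Proof.
have ge0 (t : ray) : ((omega1_0, unit_co_0 R) <= t :> ray)%O.
  rewrite leNgt; apply/negP => /ray_ltP[|[_]].
    by rewrite ltNge omega1_0_le.
  by rewrite ltNge; case/andP: (ray_height01 t) => ->.
apply/seteqP; split=> t /=; rewrite lt_neqAle ge0 andbT.
  by move=> H; apply/eqP => E; apply: H; rewrite -E.
by move=> /eqP H E; apply: H; rewrite E.
Qed.

End ClosedLongRay.

Theorem theorem1p3 (R : realType) :
  exists (M : topologicalType) (F : foliation R 2 M),
    [/\ surface R M, separable M &
      exists L0 : set (leaf_space F),
        [/\ leaf L0,
            homeomorphic L0 (long_ray R),
            forall L : set (leaf_space F),
              leaf L -> L <> L0 -> homeomorphic L [set: R] &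
            forall N : set M, set_nbhs (L0 : set M) N ->
              exists L : set (leaf_space F),
                [/\ leaf L, ~ long_leaf L & (L : set M) `&` N !=set0]]].
Proof.
have [tw] := tower_exists R; rewrite long_rayE.
exact: (tower_surface tw (ray_coords R) (omega1_0, unit_co_0 R)).
Qed.
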